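(* Let $\mathcal{F}$ be a class of functions $f:\mathcal{X}\to\mathcal{Y}$ such that (i) $f^*\in\mathcal{F}$ (realizability) and $\mathcal{F}$ is $m$-Lipschitz; (ii) the Rademacher complexity $R_n(\mathcal{F})$ decays as $O(1/\sqrt{n})$; (iii) the support of $\mathcal{D}_I$ is bounded; and (iv) the loss is $\ell(y,y')=|y-y'|$. Then there are constants $D,M$ (not depending on $n$, $\delta$, $\tau$) such that, for every $n$ and $\delta\in(0,1)$, with probability at least $1-\delta$ over $n$ i.i.d. draws $(x_i,l_i,u_i)\sim\mathcal{D}_I$, for every minimizer $f\in\mathcal{F}$ of the empirical projection objective $$\sum_{i=1}^n \Big(1[f(x_i)<l_i]\,\ell(f(x_i),l_i)+1[f(x_i)>u_i]\,\ell(f(x_i),u_i)\Big)$$ over $\mathcal{F}$ and every $\tau>0$, $$\operatorname{err}(f)\le \mathbb{E}_X\big[|u^{(m)}_{\mathcal{D}\to X}-l^{(m)}_{\mathcal{D}\to X}|\big]+\tau+\left(\frac{D}{\sqrt n}+M\sqrt{\frac{\ln(1/\delta)}{n}}\right)\Gamma(\tau),$$ where $$\Gamma(\tau)=\mathbb{E}_{\widetilde X}\left[\frac{1}{\min\big(\Pr_X(lg^{(m)}_{X\to\widetilde X}\le\tau),\ \Pr_X(ug^{(m)}_{X\to\widetilde X}\le\tau)\big)}\right]$$ is decreasing (non-increasing) in $\tau$.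
   Context: $\mathcal{X}$ is a feature space (a subset of a normed space) and $\mathcal{Y}\subseteq\mathbb{R}$ a label space. Labels are deterministic: $y=f^*(x)$ for a target function $f^*:\mathcal{X}\to\mathcal{Y}$. Each $x$ carries a fixed interval $[l_x,u_x]$ with $f^*(x)\in[l_x,u_x]$; $\mathcal{D}_I$ is the distribution of $(X,L,U)$ with $L=l_X$, $U=u_X$. $p_X$ denotes the density of the feature $X$. Distributions are assumed nonatomic in this sense: at every point with positive density, every ball around it contains a set of positive probability. $\operatorname{err}(f)=\mathbb{E}[\ell(f(X),Y)]$ with $Y=f^*(X)$. $\mathcal{F}$ is $m$-Lipschitz if $|f(x)-f(x')|\le m\|x-x'\|$ for all $f\in\mathcal{F}$ and $x,x'\in\mathcal{X}$. $R_n(\mathcal{F})=\mathbb{E}_{x_1,\dots,x_n}\mathbb{E}_{\sigma}\big[\sup_{f\in\mathcal{F}}\frac1n\sum_{i=1}^n\sigma_i f(x_i)\big]$ with $\sigma_i$ i.i.d. uniform on $\{-1,1\}$. For $x,x'\in\mathcal{X}$: $l^{(m)}_{x'\to x}=l_{x'}-m\|x-x'\|$, $u^{(m)}_{x'\to x}=u_{x'}+m\|x-x'\|$. Set $[l^{(m)}_{\mathcal{D}\to x},u^{(m)}_{\mathcal{D}\to x}]=\bigcap_{p_X(x')>0}[l^{(m)}_{x'\to x},u^{(m)}_{x'\to x}]$, i.e. $l^{(m)}_{\mathcal{D}\to x}=\sup_{p_X(x')>0}l^{(m)}_{x'\to x}$ and $u^{(m)}_{\mathcal{D}\to x}=\inf_{p_X(x')>0}u^{(m)}_{x'\to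 x}$. The lower and upper bound gaps are $lg^{(m)}_{x'\to x}=l^{(m)}_{\mathcal{D}\to x}-l^{(m)}_{x'\to x}$ and $ug^{(m)}_{x'\to x}=u^{(m)}_{x'\to x}-u^{(m)}_{\mathcal{D}\to x}$. In $\Gamma(\tau)$, $X$ and $\widetilde X$ are independent copies of the feature, and $1/0=+\infty$. *)

(* Defs.v *)
From HB Require Import structures.
From mathcomp Require Import all_boot all_order all_algebra.
From mathcomp Require Import all_classical all_reals all_analysis.
Set Implicit Arguments.
Unset Strict Implicit.
Unset Printing Implicit Defensive.
Import Order.TTheory GRing.Theory Num.Theory.
Import numFieldNormedType.Exports.
Local Open Scope classical_set_scope.
Local Open Scope ring_scope.

(* The feature space is a subset [X] of a normed space, with the induced
   metric and its Borel sigma-algebra.  The point [x0] is needed only because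
   measurable types are pointed in the library. *)
Definition feature (R : realType) (V : normedModType R) (X : set V)
  (x0 : X) : Type := set_type X.

Section feature_structures.
Context (R : realType) (V : normedModType R) (X : set V) (x0 : X).

HB.instance Definition _ := Choice.copy (feature x0) (set_type X).
HB.instance Definition _ := isPointed.Build (feature x0) x0.
HB.instance Definition _ := PseudoMetric.copy (feature x0) (set_type X).

Let borel : set (set (feature x0)) :=
  <<s [set U : set (set_type X) | open U] >>.

HB.instance Definition _ :=
  @isMeasurable.Build (sigma_display [set U : set (set_type X) | open U])
    (feature x0) borel (@sigma_algebra0 _ setT _) (@sigma_algebraC _ _)
    (@sigma_algebra_bigcup _ setT _).

End feature_structures.

Definition dist (R : realType) (V : normedModType R) (X : set V)
  (x x' : X) : R := `|set_val x - set_val x'|.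

Section iid.
Context d (T : measurableType d) (R : realType) (P : probability T R).

Definition cons_pair n (z : T * n.-tuple T) : n.+1.-tuple T :=
  [the n.+1.-tuple T of z.1 :: z.2].

Lemma measurable_cons_pair n : measurable_fun setT (@cons_pair n).
Proof. exact: measurable_cons. Qed.

HB.instance Definition _ n :=
  isMeasurableFun.Build _ _ _ _ (@cons_pair n) (@measurable_cons_pair n).

Fixpoint iid n : probability (n.-tuple T) R :=
  match n with
  | 0%N => dirac [tuple] : probability _ R
  | n'.+1 =>
      distribution (P \x iid n' : probability _ R)%E (@cons_pair n')
      : probability _ R
  end.

Lemma iid_rectangle n (A : 'I_n -> set T) : (forall i, measurable (A i)) ->
  iid n [set t | forall i, A i (tnth t i)] = (\prod_(i < n) P (A i))%E.
Proof.
elim: n A => [|n IH] A mA.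
  by rewrite big_ord0 /= diracE mem_set// => -[].
rewrite big_ord_recl -(IH (fun i => A (lift ord0 i)))//.
pose B := [set t : n.-tuple T | forall i, A (lift ord0 i) (tnth t i)].
have mB : measurable B.
  rewrite (_ : B = \bigcap_(i in [set: 'I_n])
      ((fun t => tnth t i) @^-1` A (lift ord0 i))); last first.
    by apply/seteqP; split=> t /= Bt i => [_|]; exact: Bt.
  apply: fin_bigcap_measurable => // i _.
  by rewrite -[X in measurable X]setTI; exact: measurable_tnth.
transitivity ((P \x iid n)%E (A ord0 `*` B)); last exact: product_measure1E.
rewrite [LHS]/=; congr (product_measure1 _ _ _); apply/seteqP; split=> -[x t].
  by move=> h; split=> [|i]; [exact: (h ord0)|rewrite -(tnthS x); exact: h].
by move=> [Ax Bt] i; case: (unliftP ord0 i) => [j|] -> //; rewrite tnthS.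
Qed.

(* "[G] holds with probability at least [p]"; [G] itself is not required to be
   measurable. *)
Definition with_prob_ge (p : R) (G : set T) : Prop :=
  exists A : set T, [/\ measurable A, A `<=` G & (p%:E <= P A)%E].

End iid.

Definition measure_support (R : realType) (M : pseudoMetricType R)
    (mu : set M -> \bar R) : set M :=
  [set z | forall e : R, 0 < e -> (0 < mu (ball z e))%E].

Section learning.
Context (R : realType) (V : normedModType R) (X : set V) (x0 : X).
Local Notation T := (feature x0).
Implicit Types (P : probability T R) (p : T -> R) (F : set (T -> R))
  (loss : R -> R -> R) (m tau : R) (x : T).

(* The reference measure [nu] is arbitrary: on a general normed space there is
   no Lebesgue measure to fix. *)
Definition is_density (nu : {measure set T -> \bar R}) P p : Prop :=
  [/\ measurable_fun setT p, forall x, 0 <= p x &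
    forall A, measurable A -> P A = (\int[nu]_(x in A) (p x)%:E)%E].

Definition nonatomic P p : Prop :=
  forall x, 0 < p x -> forall e : R, 0 < e ->
    exists A : set T, [/\ measurable A, A `<=` ball x e & (0 < P A)%E].

Definition err loss P (fstar f : T -> R) : \bar R :=
  (\int[P]_x (loss (f x) (fstar x))%:E)%E.

Definition lipschitz_class m F : Prop :=
  forall f, F f -> forall x x', `|f x - f x'| <= m * dist x x'.

(* The Rademacher signs [(-1) ^+ s i] are averaged over all [2 ^ n] sign
   patterns.  The supremum is taken in [\bar R] as [F] may be unbounded. *)
Definition rademacher P F n : \bar R :=
  (\int[iid P n]_x
     (((2 ^+ n)^-1)%R%:E *
      \sum_(s : {ffun 'I_n -> bool})
        ereal_sup [set (n%:R^-1 *
          \sum_(i < n) (-1) ^+ s i * f (tnth x i))%R%:E | f in F]))%E.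

Section intervals.
Variables l u : {mfun T >-> R}.

(* [(x, l_x, u_x)]; its law below is the distribution of [(X, L, U)]. *)
Definition interval_data x : T * R * R := (x, l x, u x).

Lemma measurable_interval_data : measurable_fun setT interval_data.
Proof. by apply: measurable_fun_pair => //; exact: measurable_fun_pair. Qed.

HB.instance Definition _ :=
  isMeasurableFun.Build _ _ _ _ interval_data measurable_interval_data.

Definition interval_law P : probability (T * R * R)%type R :=
  distribution P interval_data.

(* [lower_from m x' x] is the bound transported from [x'] to [x]. *)
Definition lower_from m x' x : R := l x' - m * dist x x'.
Definition upper_from m x' x : R := u x' + m * dist x x'.

Definition lower_bound m p x : \bar R :=
  ereal_sup [set (lower_from m x' x)%:E | x' in [set x' | 0 < p x']].
Definition upper_bound m p x : \bar R :=
  ereal_inf [set (upper_from m x' x)%:E | x' in [set x' | 0 < p x']].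

Definition lower_gap m p x' x : \bar R :=
  (lower_bound m p x - (lower_from m x' x)%:E)%E.
Definition upper_gap m p x' x : \bar R :=
  ((upper_from m x' x)%:E - upper_bound m p x)%E.

(* The inverse on [\bar R] satisfies [0^-1 = +oo]. *)
Definition Gamma m P p tau : \bar R :=
  (\int[P]_x
     (Order.min (P [set x' | lower_gap m p x' x <= tau%:E])
                (P [set x' | upper_gap m p x' x <= tau%:E]))^-1)%E.

End intervals.

Definition projection_loss loss (f : T -> R) (z : T * R * R) : R :=
  (f z.1.1 < z.1.2)%R%:R * loss (f z.1.1) z.1.2 +
  (f z.1.1 > z.2)%R%:R * loss (f z.1.1) z.2.

Definition projection_objective loss n (s : n.-tuple (T * R * R)%type)
    (f : T -> R) : R :=
  \sum_(i < n) projection_loss loss f (tnth s i).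

Definition is_minimizer loss F n (s : n.-tuple (T * R * R)%type)
    (f : T -> R) : Prop :=
  F f /\ forall g, F g ->
    projection_objective loss s f <= projection_objective loss s g.

End learning.

(* Main.v *)
Require Import Defs.
From mathcomp Require Import all_boot all_order all_algebra.
From mathcomp Require Import all_classical all_reals all_analysis.
From mathcomp Require Import measurable_realfun ring lra.
Set Implicit Arguments.
Unset Strict Implicit.
Unset Printing Implicit Defensive.
Import Order.TTheory GRing.Theory Num.Theory.
Import numFieldNormedType.Exports.
Local Open Scope classical_set_scope.
Local Open Scope ring_scope.

(** Since [fstar] has zero empirical objective, so does every minimizer; let
[L f] be the population projection loss of [f].  Fixing [x], averaging the
Lipschitz bounds transported from the points [x'] whose gap at [x] is at most
[tau] bounds the distance from [f x] to the interval
[[lower_bound x - tau, upper_bound x + tau]] by [L f] divided by the probability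
of such points; integrating in [x] yields [err f <= ... + L f * Gamma tau].

It remains to show that consistent [f] have [L f] of order
[(1 + sqrt (ln (1 / delta))) / sqrt n].  No concentration inequality is needed:
cut the sample into [k > ln (1 / delta)] blocks of size about [n / k].  By
symmetrization, contraction and Markov's inequality, a block is consistent with
some [f] such that [L f > C / sqrt (n / k)] with probability at most
[expR (-1)].  A function consistent with the whole sample is consistent with
every block, and the blocks are independent, so this happens for all of them
with probability at most [expR (- k) <= delta].

Suprema over the uncountable class [F] are made measurable as follows: by
[nonatomic] every ball around a point of positive density has positive
probability, so these points form a separable set of full measure, and [F] has
a countable subfamily dense for evaluation at these points and for [L]. *)

(** * Independent samples *)

Section tuples.
Context d (T : measurableType d).

Lemma measurable_cons_section n (A : set (n.+1.-tuple T)) (x : T) :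
  measurable A -> measurable [set t | A (cons_pair (x, t))].
Proof.
move=> mA; rewrite -[X in measurable X]setTI.
by apply: (measurable_cons (f := cst x) (g := id)).
Qed.

Definition tuple_split b n (t : (b + n).-tuple T) : b.-tuple T * n.-tuple T :=
  ([tuple tnth t (lshift n i) | i < b], [tuple tnth t (rshift b i) | i < n]).

Arguments tuple_split : simpl never.

Lemma measurable_tuple_split b n : measurable_fun setT (@tuple_split b n).
Proof.
apply: measurable_fun_pair; apply/measurable_fun_tnthP => i.
  rewrite (_ : _ \o _ = fun t => tnth t (lshift n i)); last first.
    by apply/funext => t /=; rewrite tnth_mktuple.
  exact: measurable_tnth.
rewrite (_ : _ \o _ = fun t => tnth t (rshift b i)); last first.
  by apply/funext => t /=; rewrite tnth_mktuple.
exact: measurable_tnth.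
Qed.

Lemma tuple_split0 n (t : n.-tuple T) : @tuple_split 0 n t = ([tuple], t).
Proof.
congr pair; first exact: tuple0.
by apply: eq_from_tnth => i; rewrite tnth_mktuple; congr tnth; apply: val_inj.
Qed.

Lemma tuple_split_cons b n (x : T) (t : (b + n).-tuple T) :
  @tuple_split b.+1 n (cons_pair (x, t)) =
  (cons_pair (x, (tuple_split t).1), (tuple_split t).2).
Proof.
congr pair; apply: eq_from_tnth => i.
  rewrite tnth_mktuple; case: (unliftP ord0 i) => [j|] ->.
    rewrite /cons_pair/= tnthS tnth_mktuple -(tnthS x t); congr tnth.
    exact: val_inj.
  by rewrite /cons_pair/= tnth0 -(tnth0 x t); congr tnth; exact: val_inj.
rewrite !tnth_mktuple -(tnthS x t); congr tnth; exact: val_inj.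
Qed.

End tuples.

Section iid_theory.
Context d (T : measurableType d) (R : realType) (P : probability T R).

Lemma iidSE n (A : set (n.+1.-tuple T)) :
  iid P n.+1 A = (\int[P]_x iid P n [set t | A (cons_pair (x, t))])%E.
Proof.
rewrite [LHS]/= /pushforward /product_measure1; apply: eq_integral => x _ /=.
congr (iid P n _); rewrite /xsection; apply/seteqP.
by split=> t /=; rewrite ?inE.
Qed.

Lemma measurable_iid_section n (A : set (n.+1.-tuple T)) : measurable A ->
  measurable_fun setT (fun x => iid P n [set t | A (cons_pair (x, t))]).
Proof.
move=> mA; have mB : measurable (@cons_pair _ T n @^-1` A).
  by rewrite -[X in measurable X]setTI; exact: measurable_cons_pair.
have := measurable_fun_xsection (iid P n) mB.
congr measurable_fun; apply/funext => x /=; congr (iid P n _).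
by rewrite /xsection; apply/seteqP; split=> t /=; rewrite inE.
Qed.

Lemma iidS_integral n (f : n.+1.-tuple T -> \bar R) :
  measurable_fun [set: n.+1.-tuple T] f -> (forall t, 0 <= f t)%E ->
  (\int[iid P n.+1]_t f t = \int[P]_x \int[iid P n]_t f (cons_pair (x, t)))%E.
Proof.
move=> mf f0.
have -> : (\int[iid P n.+1]_t f t =
   \int[(P \x iid P n)%E]_z f (cons_pair z))%E.
  rewrite /= ge0_integral_pushforward//.
rewrite (fubini_tonelli1 (fun z => f (cons_pair z)))//.
  by apply: (measurableT_comp mf); exact: measurable_cons_pair.
Qed.

(** Independence of the first [b] draws from the last [n]. By induction on [b]: the first draw is
    integrated out, the induction hypothesis applies to the sections of [A], and the constant factor
    of [B] leaves the integral. *)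
Lemma iid_split b n (A : set (b.-tuple T)) (B : set (n.-tuple T)) :
  measurable A -> measurable B ->
  iid P (b + n) (@tuple_split _ T b n @^-1` (A `*` B)) =
  (iid P b A * iid P n B)%E.
Proof.
elim: b A => [|b IH] A mA mB.
  rewrite [X in (X * _)%E]/= diracE.
  case: (boolP ([tuple] \in A)) => A0.
    rewrite mul1e; congr (iid P n _); apply/seteqP.
    split=> t; rewrite /preimage/mkset tuple_split0; first by case.
    by move=> Bt; split=> //; exact/set_mem.
  rewrite mul0e -[RHS](measure0 (iid P n)); congr (iid P n _).
  rewrite -subset0 => t; rewrite /preimage/mkset tuple_split0 => -[/mem_set].
  by rewrite (negPf A0).
rewrite (@iidSE (b + n)) [X in (X * _)%E]iidSE.
rewrite -ge0_integralZr//; last exact: measurable_iid_section.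
apply: eq_integral => x _; rewrite -IH//; last exact: measurable_cons_section.
congr (iid P _ _); apply/seteqP; split=> t;
  by rewrite /preimage/mkset tuple_split_cons.
Qed.

(** [E] asks each of [k] consecutive disjoint blocks of length [b] to lie in [A], so independence
    multiplies the bounds; leftover draws are ignored. Off [E] some block escapes [A]; it is
    returned as [s], and its entries are draws of [t]. *)
Lemma iid_blocks (b k n : nat) (A : set (b.-tuple T)) (a : R) :
  measurable A -> (iid P b A <= a%:E)%E -> (k * b <= n)%N ->
  exists E : set (n.-tuple T), [/\ measurable E, (iid P n E <= (a ^+ k)%:E)%E &
    forall t, ~ E t -> exists s : b.-tuple T,
      ~ A s /\ forall i, exists j, tnth s i = tnth t j].
Proof.
move=> mA Aa; elim: k n => [|k IH] n kb.
  exists setT; split=> //; first by rewrite expr0 probability_le1.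
  by move=> t [].
have bn : (b <= n)%N by rewrite (leq_trans _ kb)// mulSn leq_addr.
have [r nE] : exists r, n = (b + r)%N by exists (n - b)%N; rewrite subnKC.
move: kb; rewrite {}nE mulSn leq_add2l => /IH [E [mE Ea HE]].
exists (@tuple_split _ T b r @^-1` (A `*` E)); split.
- rewrite -[X in measurable X]setTI; apply: measurable_tuple_split => //.
  exact: measurableX.
- rewrite iid_split// exprS EFinM; apply: lee_pmul => //.
- move=> t; rewrite /preimage/mkset => /not_andP[As|/HE[s [As st]]].
    exists (tuple_split t).1; split=> // i; exists (lshift r i).
    by rewrite tnth_mktuple.
  exists s; split=> // i; have [j ->] := st i; exists (rshift b j).
  by rewrite tnth_mktuple.
Qed.

End iid_theory.

(** Brings events on samples of triples [(x, l x, u x)] back to samples of features, where all the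
    estimates are made. *)
Lemma iid_distribution d1 d2 (T1 : measurableType d1) (T2 : measurableType d2)
    (R : realType) (P : probability T1 R) (g : {mfun T1 >-> T2}) n
    (A : set (n.-tuple T2)) : measurable A ->
  iid (distribution P g) n A = iid P n [set t : n.-tuple T1 | A (map_tuple g t)].
Proof.
elim: n A => [|n IH] A mA.
  rewrite /= !diracE; congr ((nat_of_bool _)%:R%:E); apply/idP/idP;
    rewrite !inE /mkset; by rewrite [X in A X]tuple0 [X in _ -> A X]tuple0.
rewrite !iidSE ge0_integral_pushforward//; last first.
  exact: measurable_iid_section.
apply: eq_integral => x _ /=; rewrite IH; last exact: measurable_cons_section.
congr (iid P n _); apply/seteqP; split=> t; rewrite /mkset;
  congr (A _); exact: val_inj.
Qed.

(** * Symmetrization and contraction *)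

(** Indexing by [nat] keeps the supremum measurable in a parameter; values in [\bar R] avoid any
    boundedness assumption. *)
Definition seq_sup (R : realType) (c : nat -> R) : \bar R :=
  ereal_sup (range (fun k => (c k)%:E)).

Section seq_sup_theory.
Context (R : realType).
Implicit Types (a b c : nat -> R) (M : \bar R).

Lemma seq_sup_ge c k : ((c k)%:E <= seq_sup c)%E.
Proof. by apply: ereal_sup_ubound; exists k. Qed.

Lemma seq_sup_le c M : (forall k, (c k)%:E <= M)%E -> (seq_sup c <= M)%E.
Proof. by move=> cM; apply: ge_ereal_sup => _ [k _ <-]. Qed.

Lemma seq_sup_ge0 c : c 0%N = 0 -> (0 <= seq_sup c)%E.
Proof. by move=> c0; rewrite (le_trans _ (seq_sup_ge c 0))// c0. Qed.

Lemma seq_supD_le a b M : (forall j k, (a j + b k)%:E <= M)%E ->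
  (seq_sup a + seq_sup b <= M)%E.
Proof.
case: M => [M| |] abM; last 2 first.
- by rewrite leey.
- by have := abM 0%N 0%N.
have aM k : (seq_sup a <= M%:E - (b k)%:E)%E.
  by apply: seq_sup_le => j; rewrite leeBrDr// -EFinD.
(* The supremum of [a] is finite, lying between [a 0] and [M - b 0], so it can be moved across the
   inequality. *)
have := seq_sup_ge a 0%N; have := aM 0%N.
case: (seq_sup a) aM => [s| |] aM //= _ _.
rewrite addeC -leeBrDr//; apply: seq_sup_le => k.
by have := aM k; rewrite -!EFinB !lee_fin; lra.
Qed.

Lemma measurable_seq_sup d (T : measurableType d) (c : T -> nat -> R) :
  (forall k, measurable_fun setT (c ^~ k)) ->
  measurable_fun setT (fun x => seq_sup (c x)).
Proof.
move=> mc; have := @measurable_fun_esups _ T R setT (fun k x => (c x k)%:E).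
move=> /(_ (fun k => iffRL (measurable_EFinP _ _) (mc k)) 0%N).
congr measurable_fun; apply/funext => x; rewrite /esups /seq_sup/=.
by congr ereal_sup; apply/seteqP; split=> _ [k _ <-]; exists k.
Qed.

End seq_sup_theory.

Section sign_patterns.

Definition sign_cons n (z : bool * {ffun 'I_n -> bool}) : {ffun 'I_n.+1 -> bool} :=
  [ffun i => if unlift ord0 i is Some j then z.2 j else z.1].

Lemma sign_cons0 n z : @sign_cons n z ord0 = z.1.
Proof. by rewrite ffunE unlift_none. Qed.

Lemma sign_consS n z i : @sign_cons n z (lift ord0 i) = z.2 i.
Proof. by rewrite ffunE liftK. Qed.

(** Splits by the first sign, [true] standing for -1; this drives the inductions on the sample
    size. *)
Lemma big_sign_cons (V : nmodType) n (G : {ffun 'I_n.+1 -> bool} -> V) :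
  \sum_s G s =
  \sum_s G (sign_cons (true, s)) + \sum_s G (sign_cons (false, s)).
Proof.
rewrite (reindex (@sign_cons n))/=; last first.
  exists (fun s => (s ord0, [ffun i => s (lift ord0 i)])).
    move=> [b s] _; rewrite sign_cons0; congr pair.
    by apply/ffunP => i; rewrite ffunE sign_consS.
  move=> s _; apply/ffunP => i; case: (unliftP ord0 i) => [j|] ->.
    by rewrite sign_consS ffunE.
  by rewrite sign_cons0.
rewrite -(pair_bigA _ (fun b s => G (sign_cons (b, s))))/=.
by rewrite big_bool.
Qed.

End sign_patterns.

Section symmetrization.
Context d (T : measurableType d) (R : realType) (P : probability T R).
Context (g h : nat -> T -> R) (mu : nat -> R).
Context (mg : forall k, measurable_fun setT (g k)).
Context (mh : forall k, measurable_fun setT (h k)).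
Context (muE : forall k, (\int[P]_x (h k x)%:E = (mu k)%:E)%E).
Context (ih : forall k, P.-integrable setT (EFin \o h k)).
Context (g0 : forall x, g 0%N x = 0) (h0 : forall x, h 0%N x = 0).
Context (contr : forall j k x, `|h j x - h k x| <= `|g j x - g k x|).

Lemma mean0 : mu 0%N = 0.
Proof.
apply: EFin_inj; rewrite -muE.
by under eq_integral do rewrite h0; rewrite integral0.
Qed.

(* One coordinate at a time: Jensen replaces [mu k] by the integral of a
   supremum, and the contraction [h] of [g] is absorbed by exchanging the two
   signs when [g j x < g k x]. *)
Lemma symmetrization_step (a : nat -> R) : a 0%N = 0 ->
  (\int[P]_x seq_sup (fun k => a k + (mu k - h k x))%R <=
   \int[P]_x (2^-1%:E * (seq_sup (fun k => a k + 2 * g k x)%R +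
                         seq_sup (fun k => a k - 2 * g k x)%R)))%E.
Proof.
move=> a0.
pose S c (f : nat -> T -> R) x := seq_sup (fun k => a k + c * f k x).
have mS c f : (forall k, measurable_fun setT (f k)) ->
    measurable_fun setT (S c f).
  move=> mf; apply: measurable_seq_sup => k.
  by apply: measurable_funD => //; apply: measurable_funM.
have S0 c f x : f 0%N x = 0 -> (0 <= S c f x)%E.
  by move=> f0; apply: seq_sup_ge0; rewrite a0 f0; lra.
have hS c x : (0 <= S c h x)%E by exact: S0.
have jensen k : ((a k + 2 * mu k)%R%:E <= \int[P]_x S 2%R h x)%E.
  have -> : ((a k + 2 * mu k)%R%:E = \int[P]_x (a k + 2 * h k x)%R%:E)%E.
    under eq_integral do rewrite EFinD EFinM.
    rewrite integralD//; last 2 first.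
    - exact: finite_measure_integrable_cst.
    - exact: (integrableZl measurableT 2 (ih k)).
    rewrite integral_cst// (integralZl measurableT (ih k)) muE.
    by rewrite [X in (_ * X)%E]probability_setT mule1 EFinD EFinM.
  (* The integrand may be negative. Its negative part is dropped, and its positive part is still
     below [S 2 h], which is nonnegative because index 0 contributes 0. *)
  rewrite integralE; set A := (X in (X - _ <= _)%E).
  apply: (@le_trans _ _ A).
    by rewrite -[leRHS]sube0 leeB// integral_ge0.
  have m1 : measurable_fun setT (fun x => (a k + 2 * h k x)%:E).
    by apply/measurable_EFinP; apply: measurable_funD => //; exact: measurable_funM.
  apply: ge0_le_integral => //.
  - exact: measurable_funepos.
  - exact: mS.
  - by move=> x _; rewrite funeposE ge_max hS andbT; exact: (seq_sup_ge _ k).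
(* [a k + (mu k - h k x)] is the mean of [a k - 2 * h k x] and [a k + 2 * mu k]; the latter is
   bounded by [jensen], uniformly in [k]. This is where the factor 2 comes from. *)
apply: (@le_trans _ _ (\int[P]_x (2^-1%:E * (S (-2)%R h x + \int[P]_y S 2%R h y)))%E).
  apply: ge0_le_integral => //.
  - by move=> x _; apply: seq_sup_ge0; rewrite a0 h0 mean0; lra.
  - apply: measurable_seq_sup => k; apply: measurable_funD => //.
    exact: measurable_funB.
  - apply: emeasurable_funM => //; apply: emeasurable_funD => //; exact: mS.
  - move=> x _; apply: seq_sup_le => k.
    rewrite -lee_pdivrMl// invrK (le_trans _ (leeD (seq_sup_ge _ k) (jensen k)))//.
    by rewrite -EFinM -EFinD lee_fin; lra.
rewrite ge0_integralZl//; last 2 first.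
- by apply: emeasurable_funD => //; exact: mS.
- by move=> x _; rewrite adde_ge0// integral_ge0.
rewrite ge0_integralD//; last 2 first.
- exact: mS.
- by move=> x _; exact: integral_ge0.
rewrite integral_cst//= [X in (_ + _ * X)%E]probability_setT mule1.
rewrite -ge0_integralD//; last 2 first.
- exact: mS.
- exact: mS.
rewrite -ge0_integralZl//; last 2 first.
- by apply: emeasurable_funD; exact: mS.
- by move=> x _; rewrite adde_ge0.
apply: ge0_le_integral => //.
- by move=> x _; rewrite mule_ge0// adde_ge0.
- by apply: emeasurable_funM => //; apply: emeasurable_funD; exact: mS.
- apply: emeasurable_funM => //; apply: emeasurable_funD; first exact: mS.
  apply: measurable_seq_sup => k.
  by apply: measurable_funB => //; exact: measurable_funM.
move=> x _; apply: lee_wpmul2l => //; apply: seq_supD_le => j k.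
have := contr j k x; rewrite ler_norml => /andP[hl hu].
case: (leP (g k x) (g j x)) hl => gjk hl.
  rewrite (le_trans _ (leeD (seq_sup_ge _ j) (seq_sup_ge _ k)))//.
  by move: hl; rewrite -EFinD lee_fin ger0_norm ?subr_ge0//; lra.
rewrite (le_trans _ (leeD (seq_sup_ge _ k) (seq_sup_ge _ j)))//.
by move: hl; rewrite -EFinD lee_fin ltr0_norm ?subr_lt0//; lra.
Qed.

(** An empirical Rademacher average, not divided by [n], with the factor 2 of the symmetrization.
    The offset [c] carries the contribution of coordinates already treated in the induction. *)
Definition sign_average n (c : nat -> R) (t : n.-tuple T) : \bar R :=
  ((2 ^+ n)^-1%:E * \sum_(s : {ffun 'I_n -> bool})
     seq_sup (fun k => c k + \sum_(i < n) (-1) ^+ s i * (2 * g k (tnth t i)))%R)%E.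

Lemma sign_average_ge0 n c (t : n.-tuple T) : c 0%N = 0 ->
  (0 <= sign_average c t)%E.
Proof.
move=> c0; rewrite mule_ge0 ?lee_fin ?invr_ge0 ?exprn_ge0// sume_ge0// => s _.
by rewrite seq_sup_ge0// c0 big1 ?addr0// => i _; rewrite g0 !mulr0.
Qed.

Lemma measurable_sign_average n (c : T -> nat -> R) :
  (forall k, measurable_fun setT (c ^~ k)) ->
  measurable_fun setT (fun z : T * n.-tuple T => sign_average (c z.1) z.2).
Proof.
move=> mc; apply: emeasurable_funM => //; apply: emeasurable_sum => s.
apply: measurable_seq_sup => k; apply: measurable_funD.
  by apply: (measurableT_comp (mc k)).
apply: measurable_sum => i; apply: measurable_funM => //.
apply: measurable_funM => //; apply: (measurableT_comp (mg k)).
apply: (@measurableT_comp _ _ _ _ _ _ (fun t => tnth t i)) => //.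
exact: measurable_tnth.
Qed.

Lemma sign_average_cons n c x (t : n.-tuple T) : c 0%N = 0 ->
  sign_average c (cons_pair (x, t)) =
  (2^-1%:E * (sign_average (fun k => c k + 2 * g k x)%R t +
              sign_average (fun k => c k - 2 * g k x)%R t))%E.
Proof.
move=> c0; rewrite /sign_average big_sign_cons.
have S0 (b : bool) (s : {ffun 'I_n -> bool}) :
    (0 <= seq_sup (fun k => c k + (-1)^+ b * (2 * g k x) +
      \sum_(i < n) (-1) ^+ s i * (2 * g k (tnth t i)))%R)%E.
  by rewrite seq_sup_ge0// c0 g0 big1 ?mulr0 ?addr0// => i _; rewrite g0 !mulr0.
rewrite -ge0_muleDr; last 2 first.
- by apply: sume_ge0 => s _; have := S0 false s; under eq_fun do rewrite expr0 mul1r.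
- by apply: sume_ge0 => s _; have := S0 true s; under eq_fun do rewrite expr1 mulN1r.
rewrite muleA -EFinM -invfM -exprS addeC; congr (_ * (_ + _))%E;
  apply: eq_bigr => s _; congr seq_sup; apply/funext => k;
  rewrite big_ord_recl sign_cons0 addrA /cons_pair/= tnth0; congr (_ + _).
- by rewrite /= expr0 mul1r.
- by apply: eq_bigr => i _; rewrite sign_consS tnthS.
- by rewrite /= expr1 mulN1r.
- by apply: eq_bigr => i _; rewrite sign_consS tnthS.
Qed.

(** One-sided, since a consistent function has empirical loss zero and only an excess of its mean
    has to be excluded. *)
Definition deviation n (c : nat -> R) (t : n.-tuple T) : \bar R :=
  seq_sup (fun k => c k + \sum_(i < n) (mu k - h k (tnth t i))).

Lemma deviation_ge0 n c (t : n.-tuple T) : c 0%N = 0 -> (0 <= deviation c t)%E.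
Proof.
by move=> c0; rewrite seq_sup_ge0// c0 big1 ?addr0// => i _; rewrite mean0 h0 subr0.
Qed.

Lemma measurable_deviation n (c : T -> nat -> R) :
  (forall k, measurable_fun setT (c ^~ k)) ->
  measurable_fun setT (fun z : T * n.-tuple T => deviation (c z.1) z.2).
Proof.
move=> mc; apply: measurable_seq_sup => k; apply: measurable_funD.
  by apply: (measurableT_comp (mc k)).
apply: measurable_sum => i; apply: measurable_funB => //.
apply: (measurableT_comp (mh k)).
apply: (@measurableT_comp _ _ _ _ _ _ (fun t => tnth t i)) => //.
exact: measurable_tnth.
Qed.

Lemma deviation_cons n c x (t : n.-tuple T) :
  deviation c (cons_pair (x, t)) =
  seq_sup (fun k => c k + \sum_(i < n) (mu k - h k (tnth t i)) + (mu k - h k x)).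
Proof.
congr seq_sup; apply/funext => k; rewrite big_ord_recl /cons_pair/= tnth0.
rewrite (eq_bigr (fun i => mu k - h k (tnth t i))) ?addrA; first by ring.
by move=> i _; rewrite tnthS.
Qed.

Let measurable_tuple_section n (f : T * n.-tuple T -> \bar R) x :
  measurable_fun setT f -> measurable_fun setT (fun t => f (x, t)).
Proof. by move=> mf; exact: measurableT_comp. Qed.

Lemma measurable_sign_average_tuple n c :
  measurable_fun setT (@sign_average n c).
Proof.
apply: (@measurable_tuple_section n (fun z => sign_average c z.2) point).
exact: (@measurable_sign_average n (fun _ => c)).
Qed.

Lemma measurable_deviation_tuple n c : measurable_fun setT (@deviation n c).
Proof.
apply: (@measurable_tuple_section n (fun z => deviation c z.2) point).
exact: (@measurable_deviation n (fun _ => c)).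
Qed.

(** Induction on [n] for all offsets [c] at once. With the other draws fixed, their deviations join
    the offset and [symmetrization_step] treats the first draw [x]; with [x] fixed instead, the
    induction hypothesis applies to the offsets [c k + 2 * g k x] and [c k - 2 * g k x]. Tonelli
    exchanges the two orders of integration. *)
Lemma deviation_le_sign_average n c : c 0%N = 0 ->
  (\int[iid P n]_t deviation c t <= \int[iid P n]_t sign_average c t)%E.
Proof.
elim: n c => [|n IH] c c0.
  rewrite (eq_integral (fun t => sign_average c t))// => t _.
  rewrite /deviation /sign_average expr0 invr1 mul1e.
  under [in RHS]eq_bigr do under eq_fun do rewrite big_ord0.
  by rewrite sumr_const card_ffun card_ord expn0 mulr1n; under eq_fun do rewrite big_ord0.
pose cp x k := c k + 2 * g k x; pose cm x k := c k - 2 * g k x.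
have mcp k : measurable_fun setT (cp ^~ k).
  by apply: measurable_funD => //; exact: measurable_funM.
have mcm k : measurable_fun setT (cm ^~ k).
  by apply: measurable_funB => //; exact: measurable_funM.
have cp0 x : cp x 0%N = 0 by rewrite /cp c0 g0 mulr0 addr0.
have cm0 x : cm x 0%N = 0 by rewrite /cm c0 g0 mulr0 subr0.
pose dev2 (z : T * n.-tuple T) :=
  (2^-1%:E * (deviation (cp z.1) z.2 + deviation (cm z.1) z.2))%E.
pose sgn2 (z : T * n.-tuple T) :=
  (2^-1%:E * (sign_average (cp z.1) z.2 + sign_average (cm z.1) z.2))%E.
have dev20 z : (0 <= dev2 z)%E by rewrite mule_ge0// adde_ge0// deviation_ge0.
have sgn20 z : (0 <= sgn2 z)%E by rewrite mule_ge0// adde_ge0// sign_average_ge0.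
have mdev2 : measurable_fun setT dev2.
  by apply: emeasurable_funM => //; apply: emeasurable_funD; exact: measurable_deviation.
have msgn2 : measurable_fun setT sgn2.
  apply: emeasurable_funM => //.
  by apply: emeasurable_funD; exact: measurable_sign_average.
rewrite iidS_integral; last 2 first.
- exact: measurable_deviation_tuple.
- by move=> t; exact: deviation_ge0.
rewrite (fubini_tonelli (fun z => deviation c (cons_pair z))); last 2 first.
- apply: (measurableT_comp (@measurable_deviation_tuple n.+1 c)).
  exact: measurable_cons_pair.
- by move=> z; exact: deviation_ge0.
apply: (@le_trans _ _ (\int[iid P n]_t \int[P]_x dev2 (x, t))%E).
  apply: ge0_le_integral => //.
  - by move=> t _; apply: integral_ge0 => x _; exact: deviation_ge0.
  - apply: (measurable_fun_fubini_tonelli_G (fun z => deviation c (cons_pair z))).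
      apply: (measurableT_comp (@measurable_deviation_tuple n.+1 c)).
      exact: measurable_cons_pair.
    by move=> z; exact: deviation_ge0.
  - exact: measurable_fun_fubini_tonelli_G.
  - move=> t _; under eq_integral do rewrite deviation_cons.
    pose a k := c k + \sum_(i < n) (mu k - h k (tnth t i)).
    have a0 : a 0%N = 0.
      by rewrite /a c0 big1 ?addr0// => i _; rewrite mean0 h0 subr0.
    apply: (le_trans (symmetrization_step a0)); apply: ge0_le_integral => //.
    + move=> x _; rewrite mule_ge0// adde_ge0// seq_sup_ge0//;
      by rewrite a0 g0 mulr0 ?addr0 ?subr0.
    + apply: emeasurable_funM => //; apply: emeasurable_funD;
        apply: measurable_seq_sup => k.
      * by apply: measurable_funD => //; exact: measurable_funM.
      * by apply: measurable_funB => //; exact: measurable_funM.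
    + exact: (measurableT_comp mdev2).
    + move=> x _; rewrite lee_wpmul2l// leeD//.
      * apply: seq_sup_le => k; rewrite (le_trans _ (seq_sup_ge _ k))//.
        by rewrite lee_fin /cp /a; lra.
      * apply: seq_sup_le => k; rewrite (le_trans _ (seq_sup_ge _ k))//.
        by rewrite lee_fin /cm /a; lra.
rewrite -(fubini_tonelli dev2)//.
(* The first draw is now the outer variable, so that the induction hypothesis can be used under its
   integral. *)
apply: (@le_trans _ _ (\int[P]_x \int[iid P n]_t sgn2 (x, t))%E); last first.
  rewrite [leRHS]iidS_integral//; last 2 first.
  - exact: measurable_sign_average_tuple.
  - by move=> t; exact: sign_average_ge0.
  under [leRHS]eq_integral do under eq_integral do rewrite sign_average_cons//.
  by [].
apply: ge0_le_integral => //.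
- by move=> x _; exact: integral_ge0.
- exact: measurable_fun_fubini_tonelli_F.
- exact: measurable_fun_fubini_tonelli_F.
move=> x _; rewrite /dev2 /sgn2/=.
have md c' : measurable_fun setT (@deviation n c') by exact: measurable_deviation_tuple.
have ms c' : measurable_fun setT (@sign_average n c').
  exact: measurable_sign_average_tuple.
have d0 c' : c' 0%N = 0 -> forall t : n.-tuple T, setT t -> (0 <= deviation c' t)%E.
  by move=> c'0 t _; exact: deviation_ge0.
have s0 c' : c' 0%N = 0 -> forall t : n.-tuple T, setT t -> (0 <= sign_average c' t)%E.
  by move=> c'0 t _; exact: sign_average_ge0.
rewrite !ge0_integralZl//; last 4 first.
- by apply: emeasurable_funD.
- by move=> t tt; rewrite adde_ge0// s0.
- by apply: emeasurable_funD.
- by move=> t tt; rewrite adde_ge0// d0.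
rewrite lee_wpmul2l// !ge0_integralD//; try by [exact: s0 | exact: d0].
by rewrite leeD// IH.
Qed.

End symmetrization.

(** * Rademacher complexity of a countable subfamily *)

(* Without measurability: the integral of a nonnegative function is the
   supremum of the integrals of the simple functions below it. *)
Lemma ge0_le_integralT d (T : measurableType d) (R : realType)
    (mu : {measure set T -> \bar R}) (f g : T -> \bar R) :
  (forall x, 0 <= f x)%E -> (forall x, f x <= g x)%E ->
  (\int[mu]_x f x <= \int[mu]_x g x)%E.
Proof.
move=> f0 fg; have g0 x : (0 <= g x)%E by exact: le_trans (fg x).
rewrite !ge0_integralTE//; apply: ereal_sup_le => _ [s sf <-].
by exists s => // x; exact: le_trans (fg x).
Qed.

(** Signs are symmetric, so translating the whole family by one fixed function does not change a
    Rademacher average. *)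
Lemma sum_signs (R : realType) n (a : 'I_n -> R) :
  \sum_(s : {ffun 'I_n -> bool}) \sum_i (-1) ^+ s i * a i = 0.
Proof.
elim: n a => [|n IH] a; first by under eq_bigr do rewrite big_ord0; rewrite big1.
rewrite big_sign_cons.
have E b (s : {ffun 'I_n -> bool}) :
  \sum_i (-1) ^+ sign_cons (b, s) i * a i =
  (-1) ^+ b * a ord0 + \sum_i (-1) ^+ s i * a (lift ord0 i).
  rewrite big_ord_recl sign_cons0; congr (_ + _).
  by apply: eq_bigr => i _; rewrite sign_consS.
under eq_bigr do rewrite E; under [X in _ + X]eq_bigr do rewrite E.
rewrite !big_split/= (IH (fun i => a (lift ord0 i))) !addr0 -big_split/=.
by rewrite big1// => s _; rewrite expr0 expr1; ring.
Qed.

Section rademacher_bound.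
Context (R : realType) (V : normedModType R) (X : set V) (x0 : X).
Local Notation T := (feature x0).
Context (P : probability T R) (F : set (T -> R)) (f : nat -> T -> R).
Context (Ff : forall k, F (f k)) (mf : forall k, measurable_fun setT (f k)).

(** The supremum over the sequence is at most that over [F], and subtracting [f 0] is free by
    [sum_signs]. The factor [2 * n] restores the 2 and undoes the division by [n]. The supremum over
    [F] need not be measurable, hence the comparison by [ge0_le_integralT]. *)
Lemma sign_average_le_rademacher n : (0 < n)%N ->
  (\int[iid P n]_t sign_average (fun k x => f k x - f 0%N x)%R (fun _ => 0%R) t <=
   (2 * n%:R)%:E * rademacher P F n)%E.
Proof.
move=> n0; have n0R : 0 < 2 * n%:R :> R by rewrite mulr_gt0// ltr0n.
pose g k x := f k x - f 0%N x.
have g0 x : g 0%N x = 0 by rewrite /g subrr.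
have mg k : measurable_fun setT (g k) by exact: measurable_funB.
have msg : measurable_fun setT (sign_average g (n := n) (fun=> 0)).
  exact: measurable_sign_average_tuple.
have sg0 (t : n.-tuple T) : (0 <= sign_average g (fun=> 0%R) t)%E.
  exact: sign_average_ge0.
rewrite -lee_pdivrMl// -(ge0_integralZl _ measurableT msg); last 2 first.
- by move=> t _.
- by rewrite lee_fin invr_ge0 ltW.
apply: ge0_le_integralT => [t|t].
  by rewrite mule_ge0// lee_fin invr_ge0 ltW.
rewrite /sign_average muleCA lee_pmul2l ?lte_fin ?invr_gt0 ?exprn_gt0//.
rewrite lee_pdivrMl//.
pose G (s : {ffun 'I_n -> bool}) := ereal_sup
  [set (n%:R^-1 * (\sum_(i < n) (-1) ^+ s i * f (tnth t i)))%R%:E | f in F].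
pose c (s : {ffun 'I_n -> bool}) :=
  n%:R^-1 * \sum_(i < n) (-1) ^+ s i * f 0%N (tnth t i).
have Gc s : (0 <= G s - (c s)%:E)%E.
  by rewrite leeBrDr// add0e; apply: ereal_sup_ubound; exists (f 0%N).
(* The subtracted terms sum to zero over the sign patterns; they make every summand nonnegative, as
   distributivity in [\bar R] requires. *)
have -> : (\sum_s G s = \sum_s (G s - (c s)%:E))%E.
  rewrite big_split/= -[LHS]adde0; congr (_ + _)%E.
  rewrite sumEFin sumrN -mulr_sumr (sum_signs (fun i => f 0%N (tnth t i))).
  by rewrite mulr0 oppr0.
rewrite ge0_sume_distrr//; apply: lee_sum => s _; apply: seq_sup_le => k.
rewrite -lee_pdivrMl// leeBrDr// -EFinM -EFinD; apply: ereal_sup_ubound.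
exists (f k) => //; congr EFin.
rewrite add0r /c.
have -> : \sum_(i < n) (-1) ^+ s i * (2 * g k (tnth t i)) =
    2 * (\sum_(i < n) (-1) ^+ s i * f k (tnth t i) -
         \sum_(i < n) (-1) ^+ s i * f 0%N (tnth t i)).
  by rewrite -sumrB mulr_sumr; apply: eq_bigr => i _; rewrite /g; ring.
by field; rewrite pnatr_eq0 -lt0n.
Qed.

End rademacher_bound.

(** * The metric and the Borel structure of the feature space *)

Section dist_theory.
Context (R : realType) (V : normedModType R) (X : set V).
Implicit Types x y z : X.

Lemma dist_ge0 x y : 0 <= dist x y.
Proof. exact: normr_ge0. Qed.

Lemma dist_sym x y : dist x y = dist y x.
Proof. exact: distrC. Qed.

Lemma dist_triangle y x z : dist x z <= dist x y + dist y z.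
Proof. exact: ler_distD. Qed.

Lemma dist_diff_le x y z : `|dist x z - dist y z| <= dist x y.
Proof.
rewrite ler_norml; have := dist_triangle x y z.
have := dist_triangle y x z.
by rewrite (dist_sym y x); lra.
Qed.

End dist_theory.

Section feature_metric.
Context (R : realType) (V : normedModType R) (X : set V) (x0 : X).
Local Notation T := (feature x0).
Implicit Types x y : T.

Lemma feature_ballE x (e : R) : ball x e = [set y | dist x y < e].
Proof.
rewrite (_ : ball x e = (set_val @^-1` (ball (set_val x : V) e) : set T))//.
by rewrite -ball_normE.
Qed.

Lemma measurable_metric_open (A : set T) :
  (forall x, A x -> exists2 e : R, 0 < e & forall y, dist x y < e -> A y) ->
  measurable A.
Proof.
move=> oA; apply: sub_sigma_algebra; rewrite /mkset openE => x /oA[e e0 eA].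
by apply/nbhs_ballP; exists e => //; rewrite feature_ballE.
Qed.

Lemma measurable_lipschitz (f : T -> R) (K : R) :
  (forall x y, `|f x - f y| <= K * dist x y) -> measurable_fun setT f.
Proof.
move=> fK; apply: (measurability _ (RGenOInfty.measurableE R)) => _ [_ [a ->] <-].
rewrite setTI; apply: measurable_metric_open => x /=; rewrite in_itv/= andbT => afx.
(* A positive divisor whatever the sign of [K]. *)
have K1 : 0 < `|K| + 1 by rewrite ltr_pwDr.
exists ((f x - a) / (`|K| + 1)); first by rewrite divr_gt0// subr_gt0.
move=> y; rewrite ltr_pdivlMr// in_itv/= andbT => dxy.
have := fK x y; have := ler_norm (f x - f y).
have := ler_wpM2r (dist_ge0 x y) (ler_norm K); have := dist_ge0 x y.
lra.
Qed.

End feature_metric.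

(** * Separability and boundedness of the data *)

(** At most [k + 1] disjoint sets can have probability at least [1 / (k + 1)], and [E] is the union
    over [k] of these finite index sets. *)
Lemma trivIset_positive_countable d (T : measurableType d) (R : realType)
    (P : probability T R) (I : choiceType) (E : set I) (B : I -> set T) :
  (forall i, measurable (B i)) -> trivIset E B ->
  (forall i, E i -> (0 < P (B i))%E) -> countable E.
Proof.
move=> mB tB PB.
pose E_ k := [set i | E i /\ (k.+1%:R^-1%:E <= P (B i))%E].
have -> : E = \bigcup_k E_ k.
  apply/seteqP; split=> [i Ei|i [k _ []//]].
  have PBi : 0 < fine (P (B i)).
    by rewrite fine_gt0// PB//= ltey_eq fin_num_measure.
  exists (Num.truncn (fine (P (B i)))^-1) => //; split=> //.
  rewrite -(fineK (fin_num_measure P _ (mB i))) lee_fin.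
  by rewrite invf_ple ?posrE// ltW// truncnS_gt.
apply: bigcup_countable => // k _; apply: finite_set_countable.
apply: contrapT => /(infinite_set_fset k.+2)[Z ZE Zk].
have ZEE i : i \in finmap.enum_fset Z -> E_ k i by move=> iZ; exact: ZE.
have : (P (\big[setU/set0]_(i <- finmap.enum_fset Z) B i) <= 1)%E.
  by apply: probability_le1; apply: bigsetU_measurable => i _.
rewrite measure_fbigsetU//; last by apply: sub_trivIset tB => i /ZEE[].
apply/negP; rewrite -ltNge.
apply: (@lt_le_trans _ _ (\sum_(i <- finmap.enum_fset Z) (k.+1%:R^-1)%:E)%E); last first.
  by rewrite big_seq [leRHS]big_seq; apply: lee_sum => i /ZEE[].
rewrite sumEFin big_const_seq count_predT iter_addr_0 lte_fin.
rewrite -[ltRHS]mulr_natr ltr_pdivlMl// mulr1 ltr_nat; exact: leq_trans Zk.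
Qed.

Section support.
Context (R : realType) (V : normedModType R) (X : set V) (x0 : X).
Local Notation T := (feature x0).
Context (P : probability T R).

Lemma measurable_feature_ball (x : T) (e : R) : measurable (ball x e).
Proof.
rewrite feature_ballE; apply: measurable_metric_open => y /= xy.
exists (e - dist x y); first by rewrite subr_gt0.
by move=> z yz; have := dist_triangle y x z; lra.
Qed.

(** For each [n], take a maximal family of disjoint balls of radius [1 / (n + 1)] centred in [S]. It
    is countable because the balls have positive probability, and by maximality every point of [S]
    is within [2 / (n + 1)] of a centre. The centres for all [n] form the sequence. *)
Lemma support_separable (S : set T) : S !=set0 ->
  (forall x, S x -> forall e : R, 0 < e -> (0 < P (ball x e))%E) ->
  exists s : nat -> T, forall x, S x -> forall e, 0 < e -> exists k, dist x (s k) < e.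
Proof.
move=> S0 posS.
pose r n : R := n.+1%:R^-1.
have r0 n : 0 < r n by rewrite invr_gt0.
pose B n (x : T) := ball x (r n).
pose E n := sval (ex_maximal_disjoint_subcollection (B n) S).
have EP n : maximal_disjoint_subcollection (B n) (E n) S.
  exact: svalP (ex_maximal_disjoint_subcollection (B n) S).
have cE : countable (\bigcup_n E n).
  apply: bigcup_countable => // n _; have [ES tE _] := EP n.
  apply: (trivIset_positive_countable _ tE) => [x|x /ES Sx].
    exact: measurable_feature_ball.
  exact: posS.
have near_E n x : S x -> exists2 y, E n y & dist x y < 2 * r n.
  move=> Sx; have [ES tE maxE] := EP n; apply: contrapT => far.
  have nEx : ~ E n x.
    move=> Ex; apply: far; exists x => //.
    by rewrite /dist subrr normr0 mulr_gt0.
  (* If [x] were far from all centres, its ball could be added to the family. *)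
  apply: (maxE (E n `|` [set x])).
  - by split=> [y|/(_ x)]; [left|move=> /(_ (or_intror erefl))].
  - by move=> y [/ES//|->].
  - have disj y : E n y -> B n x `&` B n y = set0.
      move=> Ey; rewrite -subset0 => z []; rewrite /B !feature_ballE /= => xz yz.
      apply: far; exists y => //; have := dist_triangle z x y.
      by rewrite (dist_sym z y); lra.
    apply/trivIsetP => y z [Ey|->] [Ez|->] yz.
    + by move/trivIsetP : tE; exact.
    + by rewrite setIC disj.
    + by rewrite disj.
    + by rewrite eqxx in yz.
have [|[s]] := pfcard_geP cE.
  move=> E0; have [x /near_E] := S0; move=> /(_ 0%N)[y Ey _].
  by have : set0 y by rewrite -E0; exists 0%N.
exists s => x Sx e e0.
(* Chosen so that [2 / (n + 1) < e]. *)
pose n := Num.truncn (2 / e).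
have [y Ey xy] := near_E n x Sx.
have [k _ sk] : (s @` setT) y by rewrite image_eq; exists n.
exists k; rewrite sk (lt_trans xy)// ltr_pdivrMr// mulrC -ltr_pdivrMr//.
exact: truncnS_gt.
Qed.

End support.

Lemma rat_approx (R : realType) (x e : R) : 0 < e ->
  exists q : rat, `|x - ratr q| < e.
Proof.
move=> e0; have [q] := @rat_in_itvoo R (x - e) (x + e) ltac:(lra).
by rewrite in_itv/= => /andP[? ?]; exists q; rewrite ltr_norml; apply/andP; split; lra.
Qed.

Lemma inv_succ_lt (R : realType) (e : R) : 0 < e -> exists n : nat, n.+1%:R^-1 < e.
Proof.
move=> e0; exists (Num.truncn e^-1).
by rewrite invf_plt ?posrE ?truncnS_gt.
Qed.

(** There are countably many codes made of a number of coordinates, a precision and a list of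
    rationals. For each code one member of [F] matching it is chosen, if any exists; a given [i] is
    approximated by the choice made for its own rational approximations. *)
Lemma dense_sequence (R : realType) (I : Type) (F : set I) (i0 : I)
    (e : nat -> I -> R) : F i0 ->
  exists s : nat -> I, [/\ s 0%N = i0, forall k, F (s k) &
    forall i, F i -> forall (N : nat) (eps : R), 0 < eps ->
      exists k, forall j, (j < N)%N -> `|e j (s k) - e j i| < eps].
Proof.
move=> Fi0.
pose Q (c : nat * nat * seq rat) i := F i /\
  forall j, (j < c.1.1)%N -> `|e j i - ratr (nth 0 c.2 j)| < c.1.2.+1%:R^-1.
have /choice[s' s'P] c : exists i, F i /\ ((exists i', Q c i') -> Q c i).
  have [[i Qi]|nQ] := pselect (exists i, Q c i); first by exists i; split=> //; case: Qi.
  by exists i0.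
(* Index 0 is reserved for [i0], so codes are shifted by one; indices that code nothing also give
   [i0]. *)
exists (fun k => if k is k'.+1 then
  (if unpickle k' is Some c then s' c else i0) else i0); split => //.
  by case=> // k; case: unpickle => // c; have [] := s'P c.
move=> i Fi N eps eps0.
have [n n_eps] : exists n : nat, n.+1%:R^-1 < eps / 2.
  by apply: inv_succ_lt; rewrite divr_gt0.
have /choice[q qP] j : exists q : rat, `|e j i - ratr q| < n.+1%:R^-1.
  by apply: rat_approx; rewrite invr_gt0.
pose c := (N, n, mkseq q N).
exists (pickle c).+1 => j jN; rewrite pickleK /=.
have H1 : `|e j (s' c) - ratr (q j)| < n.+1%:R^-1.
  have [_ /(_ _)[|_ /(_ j jN)]] := s'P c; last by rewrite /= nth_mkseq.
  by exists i; split=> // j' j'N; rewrite /= nth_mkseq.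
have H2 := qP j; have := ler_distD (ratr (q j)) (e j (s' c)) (e j i).
rewrite (distrC (ratr (q j)) (e j i)) => H3.
by rewrite (le_lt_trans H3)// [ltRHS]splitr ltrD// (lt_trans _ n_eps).
Qed.

Section full_measure.
Context (R : realType) (V : normedModType R) (X : set V) (x0 : X).
Local Notation T := (feature x0).
Context (P : probability T R) (nu : {measure set T -> \bar R}) (p : T -> R).

Lemma measurable_density_pos : is_density nu P p -> measurable [set x | 0 < p x].
Proof.
move=> [mp _ _]; rewrite (_ : mkset _ = setT `&` p @^-1` `]0, +oo[).
  exact: mp.
by rewrite setTI; apply/seteqP; split=> x /=; rewrite in_itv/= andbT.
Qed.

Lemma density_pos_full : is_density nu P p -> P [set x | 0 < p x] = 1%E.
Proof.
move=> dp; have mS := measurable_density_pos dp; have [mp p0 PE] := dp.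
rewrite -[X in P X]setCK probability_setC; last exact: measurableC.
rewrite PE ?integral0_eq ?sube0//; last exact: measurableC.
move=> x /= /negP; rewrite -leNgt => px.
by congr EFin; apply/eqP; rewrite eq_le px p0.
Qed.

Lemma density_pos_ball (x : T) (e : R) : nonatomic P p -> 0 < p x -> 0 < e ->
  (0 < P (ball x e))%E.
Proof.
move=> naP px e0; have [A [mA AB PA]] := naP x px e e0.
by rewrite (lt_le_trans PA)// le_measure ?inE//; exact: measurable_feature_ball.
Qed.

Context (l u : {mfun T >-> R}).

Lemma measurable_lt_cst (f : T -> R) (c : R) : measurable_fun setT f ->
  measurable [set x | f x < c].
Proof.
move=> mf; rewrite (_ : mkset _ = setT `&` f @^-1` `]-oo, c[); first exact: mf.
by rewrite setTI; apply/seteqP; split=> x /=; rewrite in_itv.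
Qed.

Lemma measurable_le_cst (f : T -> R) (c : R) : measurable_fun setT f ->
  measurable [set x | f x <= c].
Proof.
move=> mf; rewrite (_ : mkset _ = setT `&` f @^-1` `]-oo, c]); first exact: mf.
by rewrite setTI; apply/seteqP; split=> x /=; rewrite in_itv.
Qed.

Lemma measurable_data_box (y : T) (a b e : R) :
  measurable [set x : T | [/\ dist y x < e, `|l x - a| < e & `|u x - b| < e]].
Proof.
rewrite (_ : mkset _ = ball y e `&` [set x | `|l x - a| < e] `&`
    [set x | `|u x - b| < e]); last first.
  by rewrite feature_ballE; apply/seteqP; split=> x /= [] => [? ? ?|[]].
apply: measurableI; first apply: measurableI.
- exact: measurable_feature_ball.
- apply: measurable_lt_cst; apply: measurableT_comp => //.
  exact: measurable_funB.
- apply: measurable_lt_cst; apply: measurableT_comp => //.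
  exact: measurable_funB.
Qed.

Definition bounded_data (B : R) : set T :=
  [set x | [/\ `|set_val x : V| <= B, `|l x| <= B & `|u x| <= B]].

(** Separability makes the law live on its support: a point of [S] violating the bound has its
    triple outside the support, hence in a null box, and so in a null box of a countable family with
    centre [s k], rational values for the bounds and radius [1 / (n + 1)]. *)
Lemma bounded_data_full (S : set T) (s : nat -> T) :
  measurable S -> P S = 1%E ->
  (forall x, S x -> forall e, 0 < e -> exists k, dist x (s k) < e) ->
  bounded_set [set ((set_val z.1.1, z.1.2, z.2) : V * R * R)
         | z in measure_support (interval_law l u P)] ->
  exists B : R, measurable (bounded_data B) /\ P (bounded_data B) = 1%E.
Proof.
move=> mS PS sS [M [_ HM]].
(* [bounded_set] only provides bounds strictly above [M]. *)
pose B := M + 1.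
have suppB z : measure_support (interval_law l u P) z ->
   `|((set_val z.1.1, z.1.2, z.2) : V * R * R)| <= B.
  by move=> Sz; apply: (HM B); [rewrite ltrDl|exists z].
have mG : measurable (bounded_data B).
  rewrite (_ : bounded_data B = [set x : T | `|set_val x : V| <= B] `&`
    [set x | `|l x| <= B] `&` [set x | `|u x| <= B]); last first.
    by apply/seteqP; split=> x /= [] => [? ? ?|[]].
  apply: measurableI; first apply: measurableI.
  - apply: measurable_le_cst; apply: (@measurable_lipschitz _ _ _ _ _ 1).
    by move=> x y; rewrite mul1r; exact: ler_dist_dist.
  - by apply: measurable_le_cst; exact: measurableT_comp.
  - by apply: measurable_le_cst; exact: measurableT_comp.
exists B; split=> //.
pose N (c : nat * rat * rat * nat) : set T :=
  [set y | [/\ dist (s c.1.1.1) y < c.2.+1%:R^-1,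
    `|l y - ratr c.1.1.2| < c.2.+1%:R^-1 & `|u y - ratr c.1.2| < c.2.+1%:R^-1]].
(* Enumerates the null boxes only; all other indices give the empty set. *)
pose N' k := if unpickle k is Some c then
  (if `[< P (N c) = 0%E >] then N c else set0) else set0.
have mN c : measurable (N c) by exact: measurable_data_box.
have negN' : P.-negligible (\bigcup_k N' k).
  apply: negligible_bigcup => k; rewrite /N'.
  case: unpickle => [c|]; last exact: negligible_set0.
  case: asboolP => [PN|_]; last exact: negligible_set0.
  exact/(negligibleP _ (mN c)).
have sub : S `&` ~` bounded_data B `<=` \bigcup_k N' k.
  move=> x [Sx nbx].
  have nsx : ~ measure_support (interval_law l u P) (x, l x, u x).
    move=> /suppB; rewrite !prod_normE/= !ge_max => /andP[/andP[? ?] ?].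
    exact: nbx.
  have [e e0 Pe] : exists2 e : R, 0 < e &
      P [set y : T | [/\ dist x y < e, `|l y - l x| < e & `|u y - u x| < e]] = 0%E.
    apply: contrapT => H; apply: nsx => e e0.
    rewrite lt0e measure_ge0 andbT; apply/eqP => Pz; apply: H; exists e => //.
    rewrite -Pz /interval_law/= /pushforward; congr (P _).
    apply/seteqP; split=> y /=; rewrite /ball/= /prod_ball/=.
      case=> xy ly uy; split; last by rewrite -ball_normE/= distrC.
      split; last by rewrite -ball_normE/= distrC.
      by rewrite [X in X _](feature_ballE x).
    case=> -[+ +] +; rewrite -!ball_normE/= [X in X _ -> _](feature_ballE x)/=.
    by rewrite (distrC (l x)) (distrC (u x)).
  (* A radius below [e / 2] keeps any such box containing the data of [x] inside the null box of
     size [e] around [x]. *)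
  have [n ne] : exists n : nat, n.+1%:R^-1 < e / 2.
    by apply: inv_succ_lt; rewrite divr_gt0.
  have r0 : 0 < n.+1%:R^-1 :> R by rewrite invr_gt0.
  have [k xk] := sS x Sx _ r0.
  have [q1 lq] := rat_approx (l x) r0.
  have [q2 uq] := rat_approx (u x) r0.
  exists (pickle (k, q1, q2, n)) => //; rewrite /N' pickleK.
  rewrite asboolT; first by split => //=; rewrite dist_sym.
  apply/eqP; rewrite eq_le measure_ge0 andbT -[leRHS]Pe le_measure ?inE//.
    exact: measurable_data_box.
  move=> y [/= sy ly uy]; move: ne sy ly uy xk lq uq; clear r0.
  move: (n.+1%:R^-1) => r ne sy ly uy xk lq uq; split.
  - by have := dist_triangle (s k) x y; lra.
  - have := ler_distD (ratr q1) (l y) (l x); rewrite (distrC (ratr q1)); lra.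
  - have := ler_distD (ratr q2) (u y) (u x); rewrite (distrC (ratr q2)); lra.
have negG : P.-negligible (~` bounded_data B).
  apply: (@negligibleS _ _ _ _ (~` S `|` \bigcup_k N' k)).
    by move=> x nbx; have [Sx|nSx] := pselect (S x); [right; exact: sub|left].
  have PS0 : P (~` S) = 0%E by rewrite probability_setC// PS subee.
  by apply: negligibleU => //; apply/negligibleP => //; exact: measurableC.
have PG : P (~` bounded_data B) = 0%E.
  by apply: measure_negligible => //; exact: measurableC.
by rewrite -[bounded_data B]setCK probability_setC ?PG ?sube0//; exact: measurableC.
Qed.

End full_measure.

(** * The deterministic risk bound *)

Lemma inve_gt (R : realType) (a : R) (q : \bar R) : 0 <= a -> (0 <= q)%E ->
  (a%:E < q^-1)%E = (q < (a%:E)^-1)%E.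
Proof.
move=> a0 q0; rewrite -[in LHS](inveK a%:E) lte_pV2//.
by rewrite inE inve_ge0 lee_fin.
Qed.

Lemma measurable_inve d (T : measurableType d) (R : realType) (q : T -> \bar R) :
  measurable_fun setT q -> (forall x, 0 <= q x)%E ->
  measurable_fun setT (fun x => (q x)^-1)%E.
Proof.
move=> mq q0; apply: (measurability _ (ErealGenOInfty.measurableE R)).
move=> _ [_ [a ->] <-].
have [a0|a0] := leP 0 a.
  rewrite (_ : _ `&` _ = setT `&` [set x | q x < (a%:E)^-1]%E).
    exact: emeasurable_fun_infty_o.
  by rewrite !setTI; apply/seteqP; split=> x /=; rewrite in_itv/= andbT inve_gt.
rewrite (_ : _ `&` _ = setT)// setTI; apply/seteqP; split=> x //= _.
by rewrite in_itv/= andbT (@lt_le_trans _ _ 0%E) ?lte_fin ?inve_ge0.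
Qed.

Section lipschitz_families.
Context (R : realType) (V : normedModType R) (X : set V) (x0 : X).
Local Notation T := (feature x0).

(** A pointwise bounded supremum of functions with a common Lipschitz constant inherits that
    constant. Hence the transported bounds are real-valued and measurable although the supremum is
    over an uncountable set. *)
Lemma lipschitz_sup (S : set T) (phi : T -> T -> R) (b : T -> R) (K : R) :
  S !=set0 -> (forall x' x, S x' -> phi x' x <= b x) ->
  (forall x' x y, S x' -> `|phi x' x - phi x' y| <= K * dist x y) ->
  exists L : T -> R, [/\
    forall x, ereal_sup [set (phi x' x)%:E | x' in S] = (L x)%:E,
    forall x' x, S x' -> phi x' x <= L x, forall x, L x <= b x &
    forall x y, `|L x - L y| <= K * dist x y].
Proof.
move=> [z Sz] phib phiK.
pose s x := ereal_sup [set (phi x' x)%:E | x' in S].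
have sb x : (s x <= (b x)%:E)%E.
  by apply: ge_ereal_sup => _ [x' Sx' <-]; rewrite lee_fin phib.
have s_ge x' x : S x' -> ((phi x' x)%:E <= s x)%E.
  by move=> Sx'; apply: ereal_sup_ubound; exists x'.
have sE x : s x = (fine (s x))%:E.
  rewrite fineK// fin_numElt (lt_le_trans _ (s_ge z x Sz)) ?ltNyr//.
  by rewrite (le_lt_trans (sb x))// ltry.
exists (fine \o s); split=> [x|x' x Sx'|x|x y].
- exact: sE.
- by rewrite -lee_fin -sE s_ge.
- by rewrite -lee_fin -sE.
have half x1 y1 : fine (s x1) <= fine (s y1) + K * dist x1 y1.
  rewrite -lee_fin -sE; apply: ge_ereal_sup => _ [x' Sx' <-].
  have : phi x' y1 <= fine (s y1) by rewrite -lee_fin -sE s_ge.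
  by rewrite lee_fin; have := phiK x' x1 y1 Sx'; rewrite ler_norml => /andP[]; lra.
by rewrite /= ler_norml; have := half x y; have := half y x;
  rewrite (dist_sym y x); lra.
Qed.

Lemma lipschitz_inf (S : set T) (phi : T -> T -> R) (b : T -> R) (K : R) :
  S !=set0 -> (forall x' x, S x' -> b x <= phi x' x) ->
  (forall x' x y, S x' -> `|phi x' x - phi x' y| <= K * dist x y) ->
  exists L : T -> R, [/\
    forall x, ereal_inf [set (phi x' x)%:E | x' in S] = (L x)%:E,
    forall x' x, S x' -> L x <= phi x' x, forall x, b x <= L x &
    forall x y, `|L x - L y| <= K * dist x y].
Proof.
move=> S0 phib phiK.
have [|x' x y Sx'|L [LE phiL Lb LK]] :=
    @lipschitz_sup S (fun x' x => - phi x' x) (fun x => - b x) K S0.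
- by move=> x' x Sx'; rewrite lerN2 phib.
- by rewrite -opprD normrN phiK.
exists (fun x => - L x); split=> [x|x' x Sx'|x|x y].
- rewrite EFinN -LE /ereal_inf image_comp/=; congr (- ereal_sup _)%E.
- by rewrite lerNl phiL.
- by rewrite lerNr Lb.
- by rewrite -opprD normrN.
Qed.

(** The map is upper semicontinuous: a small move from [x] to [y] puts [q _ y <= tau] inside
    [q _ x <= tau + 1 / (n + 1)], and the probabilities of the latter sets decrease to that of
    [q _ x <= tau]. *)
Lemma measurable_probability_gap (P : probability T R) (q : T -> T -> R) (K tau : R) :
  (forall x, measurable_fun setT (q ^~ x)) ->
  (forall x' x y, `|q x' x - q x' y| <= K * dist x y) ->
  measurable_fun setT (fun x => P [set x' | q x' x <= tau]).
Proof.
move=> mq qK; apply: (measurability _ (ErealGenInftyO.measurableE R)).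
move=> _ [_ [a ->] <-]; rewrite setTI; apply: measurable_metric_open => x /=.
rewrite in_itv/= => Pa.
pose A n := [set x' | q x' x <= tau + n.+1%:R^-1].
have mA n : measurable (A n) by exact: measurable_le_cst.
have capA : \bigcap_n A n = [set x' | q x' x <= tau].
  apply/seteqP; split=> x'; last first.
    by move=> /= qt n _; rewrite /A /= (le_trans qt)// lerDl invr_ge0.
  move=> qA /=; rewrite leNgt; apply/negP => qt.
  have [n] : exists n : nat, n.+1%:R^-1 < q x' x - tau.
    by apply: inv_succ_lt; rewrite subr_gt0.
  have := qA n I; rewrite /A /=; move: n.+1%:R^-1 => r; lra.
have : P \o A @ \oo --> P (\bigcap_n A n).
  apply: nonincreasing_cvg_mu => //.
  - by rewrite ltey_eq fin_num_measure.
  - exact: bigcapT_measurable.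
  - apply/nonincreasing_seqP => n; apply/subsetPset => x' /= /le_trans; apply.
    by rewrite lerD2l lef_pV2 ?posrE// ler_nat.
rewrite capA => PA.
have [n PAn] : exists n, (P (A n) < a%:E)%E.
  apply: contrapT => PAa; move: Pa; rewrite ltNge => /negP; apply.
  rewrite -(cvg_lim _ PA)//; apply: lime_ge; first exact: cvgP PA.
  by apply: nearW => n; rewrite leNgt; apply/negP => PAn; apply: PAa; exists n.
have K1 : 0 < `|K| + 1 by rewrite ltr_pwDr.
exists (n.+1%:R^-1 / (`|K| + 1)); first by rewrite divr_gt0// invr_gt0.
move=> y; rewrite ltr_pdivlMr// in_itv/= => dxy.
apply: le_lt_trans PAn; rewrite le_measure ?inE//; first exact: measurable_le_cst.
move=> x' /= qy; rewrite /A/=; move: dxy; move: n.+1%:R^-1 => r dxy.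
have := qK x' x y; rewrite ler_norml => /andP[_].
have := ler_wpM2r (dist_ge0 x y) (ler_norm K).
have := dist_ge0 x y.
lra.
Qed.

End lipschitz_families.

Lemma ge0_markov_set d (T : measurableType d) (R : realType) (P : probability T R)
    (A : set T) (h : T -> R) (a : R) :
  measurable A -> measurable_fun setT h -> (forall x, 0 <= h x) -> 0 <= a ->
  (forall x, A x -> a <= h x) ->
  (a%:E * P A <= \int[P]_x (h x)%:E)%E.
Proof.
move=> mA mh h0 a0 ah; have mhE : measurable_fun setT (EFin \o h).
  exact/measurable_EFinP.
rewrite -integral_cst//.
apply: (@le_trans _ _ (\int[P]_(x in A) (h x)%:E)%E).
  apply: ge0_le_integral => //.
  exact: measurable_funS mhE.
by apply: ge0_subset_integral => // x _; rewrite lee_fin.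
Qed.

Lemma le_mul_inve (R : realType) (a c : R) (q : \bar R) :
  0 <= a -> 0 < c -> (0 <= q <= 1)%E -> (a%:E * q <= c%:E)%E ->
  (a%:E <= c%:E * q^-1)%E.
Proof.
move=> a0 c0; case: q => [q||]; [|by case/andP|by case/andP].
rewrite !lee_fin => /andP[q0 q1] aq; rewrite inver.
(* For [q = 0] the right-hand side is [+oo]; positivity of [c] rules out the product
   [0 * +oo = 0]. *)
case: eqVneq => [_|qn0]; first by rewrite gt0_muley ?leey ?lte_fin.
by rewrite -EFinM lee_fin ler_pdivlMr// lt_neqAle eq_sym qn0.
Qed.

Section risk.
Context (R : realType) (V : normedModType R) (X : set V) (x0 : X).
Local Notation T := (feature x0).
Context (P : probability T R) (p : T -> R) (l u : {mfun T >-> R}).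
Context (fstar : T -> R) (m : R).
Context (S0 : [set x | 0 < p x] !=set0).
Context (between : forall x, l x <= fstar x <= u x).
Context (fstar_lip : forall x x', `|fstar x - fstar x'| <= m * dist x x').

(** The distance from [f x] to [[l x, u x]]; at most one of the two terms is nonzero when
    [l x <= u x]. *)
Definition interval_loss (f : T -> R) (x : T) : R :=
  Num.max 0 (l x - f x) + Num.max 0 (f x - u x).

Lemma interval_loss_ge0 f x : 0 <= interval_loss f x.
Proof. by rewrite addr_ge0// le_max lexx. Qed.

Lemma measurable_interval_loss f : measurable_fun setT f ->
  measurable_fun setT (interval_loss f).
Proof.
move=> mf; apply: measurable_funD; apply: measurable_maxr => //;
  exact: measurable_funB.
Qed.

(** The distance to an interval is 1-Lipschitz. This is the contraction fed to the
    symmetrization. *)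
Lemma interval_loss_lip f g x :
  `|interval_loss f x - interval_loss g x| <= `|f x - g x|.
Proof.
have /andP[lf fu] := between x; have {lf fu} lu := le_trans lf fu.
rewrite /interval_loss.
have := ler_norm (f x - g x); have := ler_norm (g x - f x).
rewrite distrC => h1 h2; rewrite ler_norml.
by do 4 (case: (leP 0 (_ : R)) => ?); apply/andP; split; lra.
Qed.

(** Every transported lower bound is at most [fstar x], because [fstar] is itself Lipschitz and
    above [l]. The constant is the absolute value of [m] since the sign of [m] is not assumed. *)
Lemma lower_boundE : exists L : T -> R, [/\ forall x, lower_bound l m p x = (L x)%:E,
  forall x, L x <= fstar x & forall x y, `|L x - L y| <= `|m| * dist x y].
Proof.
have [||L [LE _ Lb LK]] := @lipschitz_sup _ _ _ x0 [set x | 0 < p x]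
  (fun x' x => lower_from l m x' x) fstar `|m| S0.
- move=> x' x _; rewrite /lower_from; have /andP[lf _] := between x'.
  have := fstar_lip x x'; rewrite ler_norml => /andP[]; lra.
- move=> x' x y _; rewrite /lower_from.
  have -> : l x' - m * dist x x' - (l x' - m * dist y x') =
    m * (dist y x' - dist x x') by ring.
  rewrite normrM.
  rewrite ler_wpM2l// ler_norml.
  have := dist_triangle x y x'; have := dist_triangle y x x'.
  by rewrite (dist_sym y x); lra.
by exists L.
Qed.

Lemma upper_boundE : exists U : T -> R, [/\ forall x, upper_bound u m p x = (U x)%:E,
  forall x, fstar x <= U x & forall x y, `|U x - U y| <= `|m| * dist x y].
Proof.
have [||L [LE _ Lb LK]] := @lipschitz_inf _ _ _ x0 [set x | 0 < p x]
  (fun x' x => upper_from u m x' x) fstar `|m| S0.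
- move=> x' x _; rewrite /upper_from; have /andP[_ fu] := between x'.
  have := fstar_lip x x'; rewrite ler_norml => /andP[]; lra.
- move=> x' x y _; rewrite /upper_from.
  have -> : u x' + m * dist x x' - (u x' + m * dist y x') =
    m * (dist x x' - dist y x') by ring.
  rewrite normrM.
  rewrite ler_wpM2l// ler_norml.
  have := dist_triangle x y x'; have := dist_triangle y x x'.
  by rewrite (dist_sym y x); lra.
by exists L.
Qed.

Lemma lower_gapE L x' x tau : (forall x, lower_bound l m p x = (L x)%:E) ->
  (lower_gap l m p x' x <= tau%:E)%E = (L x - lower_from l m x' x <= tau).
Proof. by move=> LE; rewrite /lower_gap LE -EFinB lee_fin. Qed.

Lemma upper_gapE U x' x tau : (forall x, upper_bound u m p x = (U x)%:E) ->
  (upper_gap u m p x' x <= tau%:E)%E = (upper_from u m x' x - U x <= tau).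
Proof. by move=> UE; rewrite /upper_gap UE -EFinB lee_fin. Qed.

Lemma measurable_dist_l (x : T) : measurable_fun setT (fun x' : T => dist x x').
Proof.
apply: (@measurable_lipschitz _ _ _ _ _ 1) => x1 x2.
by rewrite mul1r !(dist_sym x) dist_diff_le.
Qed.

Lemma measurable_lower_from x : measurable_fun setT (fun x' => lower_from l m x' x).
Proof.
by apply: measurable_funB => //; apply: measurable_funM => //; exact: measurable_dist_l.
Qed.

Lemma measurable_upper_from x : measurable_fun setT (fun x' => upper_from u m x' x).
Proof.
by apply: measurable_funD => //; apply: measurable_funM => //; exact: measurable_dist_l.
Qed.

Lemma measurable_lower_gap_set x tau :
  measurable [set x' | lower_gap l m p x' x <= tau%:E]%E.
Proof.
have [L [LE _ _]] := lower_boundE.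
rewrite (_ : mkset _ = [set x' | L x - lower_from l m x' x <= tau]); last first.
  by apply/seteqP; split=> x' /=; rewrite (lower_gapE _ _ _ LE).
apply: measurable_le_cst; apply: measurable_funB => //; exact: measurable_lower_from.
Qed.

Lemma measurable_upper_gap_set x tau :
  measurable [set x' | upper_gap u m p x' x <= tau%:E]%E.
Proof.
have [L [LE _ _]] := upper_boundE.
rewrite (_ : mkset _ = [set x' | upper_from u m x' x - L x <= tau]); last first.
  by apply/seteqP; split=> x' /=; rewrite (upper_gapE _ _ _ LE).
apply: measurable_le_cst; apply: measurable_funB => //; exact: measurable_upper_from.
Qed.

Definition gap_probability tau x : \bar R :=
  Order.min (P [set x' | lower_gap l m p x' x <= tau%:E]%E)
            (P [set x' | upper_gap u m p x' x <= tau%:E]%E).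

Lemma gap_probability_itv tau x : (0 <= gap_probability tau x <= 1)%E.
Proof.
rewrite le_min !measure_ge0/= ge_min probability_le1//.
exact: measurable_lower_gap_set.
Qed.

Lemma measurable_gap_probability tau : measurable_fun setT (gap_probability tau).
Proof.
have [L [LE _ LK]] := lower_boundE; have [U [UE _ UK]] := upper_boundE.
apply: measurable_mine.
  rewrite (_ : (fun _ => _) = fun x => P [set x' | L x - lower_from l m x' x <= tau]).
    apply: (@measurable_probability_gap _ _ _ _ P
      (fun x' x => L x - lower_from l m x' x) (2 * `|m|)) => [x|x' x y].
      by apply: measurable_funB => //; exact: measurable_lower_from.
    rewrite /lower_from.
    have -> : L x - (l x' - m * dist x x') - (L y - (l x' - m * dist y x')) =
      (L x - L y) + m * (dist x x' - dist y x') by ring.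
    rewrite (le_trans (ler_normD _ _))// mulrDl mul1r mulrDl lerD// normrM.
    by rewrite ler_wpM2l// dist_diff_le.
  apply/funext => x; congr (P _); apply/seteqP; split=> x' /=;
  by rewrite (lower_gapE _ _ _ LE).
rewrite (_ : (fun _ => _) = fun x => P [set x' | upper_from u m x' x - U x <= tau]).
  apply: (@measurable_probability_gap _ _ _ _ P
    (fun x' x => upper_from u m x' x - U x) (2 * `|m|)) => [x|x' x y].
    by apply: measurable_funB => //; exact: measurable_upper_from.
  rewrite /upper_from.
  have -> : u x' + m * dist x x' - U x - (u x' + m * dist y x' - U y) =
    - (U x - U y) + m * (dist x x' - dist y x') by ring.
  rewrite (le_trans (ler_normD _ _))// mulrDl mul1r mulrDl lerD// ?normrN// normrM.
  by rewrite ler_wpM2l// dist_diff_le.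
apply/funext => x; congr (P _); apply/seteqP; split=> x' /=;
by rewrite (upper_gapE _ _ _ UE).
Qed.

Lemma gap_probability_le tau1 tau2 x : tau1 <= tau2 ->
  (gap_probability tau1 x <= gap_probability tau2 x)%E.
Proof.
move=> t12; rewrite /gap_probability le_min !ge_min.
apply/andP; split; apply/orP; [left|right].
  apply: le_measure; rewrite ?inE; try exact: measurable_lower_gap_set.
  by move=> x' /= /le_trans; apply; rewrite lee_fin.
apply: le_measure; rewrite ?inE; try exact: measurable_upper_gap_set.
by move=> x' /= /le_trans; apply; rewrite lee_fin.
Qed.

Lemma Gamma_nonincreasing tau1 tau2 : tau1 <= tau2 ->
  (Gamma l u m P p tau2 <= Gamma l u m P p tau1)%E.
Proof.
move=> t12; have gp0 tau x : (0 <= gap_probability tau x)%E.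
  by have /andP[] := gap_probability_itv tau x.
apply: ge0_le_integralT => x; first by rewrite inve_ge0; exact: gp0.
by rewrite lee_pV2 ?inE//; [exact: gap_probability_le|exact: gp0|exact: gp0].
Qed.

(** Where [f x] stays within [tau] of [[L x, U x]], its distance to [fstar x] is at most
    [U x - L x + tau]. Any further excess is paid by [c] over the gap probability. *)
Lemma risk_bound (f : T -> R) (c tau : R) :
  (forall x x', `|f x - f x'| <= m * dist x x') -> 0 < c -> 0 < tau ->
  (\int[P]_x (interval_loss f x)%:E <= c%:E)%E ->
  (\int[P]_x (`|f x - fstar x|)%:E <=
     \int[P]_x `|upper_bound u m p x - lower_bound l m p x| + tau%:E
       + c%:E * Gamma l u m P p tau)%E.
Proof.
move=> f_lip c0 tau0 fc.
have [L [LE Lf LK]] := lower_boundE; have [U [UE fU UK]] := upper_boundE.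
have mf := measurable_lipschitz f_lip.
have mil := measurable_interval_loss mf.
have gp0 x : (0 <= gap_probability tau x)%E.
  by have /andP[] := gap_probability_itv tau x.
(* Markov's inequality. It is applied to the points [x'] whose gap at [x] is at most [tau]: moving
   from [x] to [x'] changes [f] by no more than the transport term, so an excess [a] at [x] forces a
   loss of at least [a] at [x']. *)
have excess (a : R) (A : set T) x : measurable A -> 0 <= a ->
    (forall x', A x' -> a <= interval_loss f x') ->
    (gap_probability tau x <= P A)%E ->
    (a%:E <= c%:E * (gap_probability tau x)^-1)%E.
  move=> mA a0 aA gA; apply: le_mul_inve => //; first exact: gap_probability_itv.
  apply: le_trans fc; apply: le_trans (ge0_markov_set P mA mil _ a0 aA).
    by rewrite lee_wpmul2l// lee_fin.
  by move=> x'; exact: interval_loss_ge0.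
have exL x : ((Num.max 0 (L x - tau - f x))%:E <= c%:E * (gap_probability tau x)^-1)%E.
  apply: (excess _ [set x' | lower_gap l m p x' x <= tau%:E]%E).
  - exact: measurable_lower_gap_set.
  - by rewrite le_max lexx.
  - move=> x' /=; rewrite (lower_gapE _ _ _ LE) /lower_from /interval_loss => gx'.
    have := f_lip x x'; rewrite ler_norml => /andP[h1 h2].
    have m2 : 0 <= Num.max 0 (f x' - u x') by rewrite le_max lexx.
    have m1 : 0 <= Num.max 0 (l x' - f x') by rewrite le_max lexx.
    have m3 : l x' - f x' <= Num.max 0 (l x' - f x') by rewrite le_max lexx orbT.
    by rewrite ge_max; apply/andP; split; lra.
  - by rewrite /gap_probability ge_min lexx.
have exU x : ((Num.max 0 (f x - tau - U x))%:E <= c%:E * (gap_probability tau x)^-1)%E.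
  apply: (excess _ [set x' | upper_gap u m p x' x <= tau%:E]%E).
  - exact: measurable_upper_gap_set.
  - by rewrite le_max lexx.
  - move=> x' /=; rewrite (upper_gapE _ _ _ UE) /upper_from /interval_loss => gx'.
    have := f_lip x x'; rewrite ler_norml => /andP[h1 h2].
    have m2 : 0 <= Num.max 0 (f x' - u x') by rewrite le_max lexx.
    have m1 : 0 <= Num.max 0 (l x' - f x') by rewrite le_max lexx.
    have m3 : f x' - u x' <= Num.max 0 (f x' - u x') by rewrite le_max lexx orbT.
    by rewrite ge_max; apply/andP; split; lra.
  - by rewrite /gap_probability ge_min lexx orbT.
have gapE x : (`|upper_bound u m p x - lower_bound l m p x|)%E = (U x - L x)%:E.
  by rewrite UE LE -EFinB abse_EFin ger0_norm// subr_ge0 (le_trans (Lf x)).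
have mG : measurable_fun setT (fun x => (gap_probability tau x)^-1)%E.
  by apply: measurable_inve => //; exact: measurable_gap_probability.
have mUL : measurable_fun setT (fun x => (U x - L x)%:E).
  apply/measurable_EFinP; apply: measurable_funB.
    exact: measurable_lipschitz UK.
  exact: measurable_lipschitz LK.
have UL0 x : 0 <= U x - L x by rewrite subr_ge0 (le_trans (Lf x)).
have G0 x : (0 <= (gap_probability tau x)^-1)%E by rewrite inve_ge0.
have -> : Gamma l u m P p tau = (\int[P]_x (gap_probability tau x)^-1)%E by [].
rewrite -ge0_integralZl//; last by rewrite lee_fin ltW.
rewrite [X in (_ <= _ + X + _)%E](_ : _ = \int[P]_x tau%:E)%E; last first.
  by rewrite integral_cst// [X in (_ * X)%E]probability_setT mule1.
under [X in (_ <= X + _ + _)%E]eq_integral do rewrite gapE.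
rewrite -ge0_integralD//; last 2 first.
- by move=> x _; rewrite lee_fin.
- by move=> x _; rewrite lee_fin ltW.
rewrite -ge0_integralD//; last 4 first.
- by move=> x _; rewrite -EFinD lee_fin addr_ge0// ltW.
- exact: emeasurable_funD.
- by move=> x _; rewrite mule_ge0// lee_fin ltW.
- exact: emeasurable_funM.
apply: ge0_le_integralT => x; first by rewrite lee_fin.
rewrite -EFinD.
(* Inside the enlarged interval, below it, above it; the fourth case contradicts [L x <= U x]. *)
have [fU'|Uf] := leP (f x) (U x + tau); have [Lf'|fL] := leP (L x - tau) (f x).
- rewrite lee_paddr ?mule_ge0 ?lee_fin ?(ltW c0)//.
  by have := Lf x; have := fU x; rewrite ler_norml; lra.
- rewrite (le_trans _ (leeD2l _ (exL x)))// -EFinD lee_fin.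
  have m3 : L x - tau - f x <= Num.max 0 (L x - tau - f x) by rewrite le_max lexx orbT.
  by have := Lf x; have := fU x; rewrite ler_norml; lra.
- rewrite (le_trans _ (leeD2l _ (exU x)))// -EFinD lee_fin.
  have m3 : f x - tau - U x <= Num.max 0 (f x - tau - U x) by rewrite le_max lexx orbT.
  by have := Lf x; have := fU x; rewrite ler_norml; lra.
- by exfalso; have := UL0 x; lra.
Qed.

End risk.

(** * Uniform deviation of consistent functions *)

Lemma probability_full_setC d (T : measurableType d) (R : realType)
    (P : probability T R) (S : set T) :
  measurable S -> P S = 1%E -> P (~` S) = 0%E.
Proof. by move=> mS PS; rewrite probability_setC// PS subee. Qed.

Lemma le_integral_full d (T : measurableType d) (R : realType)
    (P : probability T R) (S : set T) (h : T -> R) (K : R) :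
  measurable S -> P S = 1%E -> measurable_fun setT h -> (forall x, 0 <= h x) ->
  (forall x, S x -> h x <= K) -> (\int[P]_x (h x)%:E <= K%:E)%E.
Proof.
move=> mS PS mh h0 hK.
have [x Sx] : S !=set0.
  apply/set0P/eqP => S0; move: PS; rewrite S0 measure0 => /esym/eqP.
  by rewrite onee_eq0.
have K0 : 0 <= K by rewrite (le_trans _ (hK x Sx)).
have -> : (K%:E = \int[P]_x K%:E)%E.
  by rewrite integral_cst// [X in (_ * X)%E]probability_setT mule1.
apply: ae_ge0_le_integral => //.
- by move=> y _; rewrite lee_fin.
- exact/measurable_EFinP.
- exists (~` S); split; [exact: measurableC|exact: probability_full_setC|].
  by move=> y /= hy Sy; apply: hy => _; rewrite lee_fin hK.
Qed.

Lemma integrable_full d (T : measurableType d) (R : realType)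
    (P : probability T R) (S : set T) (h : T -> R) (K : R) :
  measurable S -> P S = 1%E -> measurable_fun setT h -> (forall x, 0 <= h x) ->
  (forall x, S x -> h x <= K) -> P.-integrable setT (EFin \o h).
Proof.
move=> mS PS mh h0 hK; apply/integrableP; split; first exact/measurable_EFinP.
under eq_integral do rewrite /= ger0_norm//.
by rewrite (le_lt_trans (le_integral_full mS PS mh h0 hK))// ltry.
Qed.

Lemma measurable_tuple_all d (T : measurableType d) (S : set T) n :
  measurable S -> measurable [set t : n.-tuple T | forall i, S (tnth t i)].
Proof.
move=> mS; rewrite (_ : mkset _ = \bigcap_(i in [set: 'I_n])
    ((fun t : n.-tuple T => tnth t i) @^-1` S)); last first.
  by apply/seteqP; split=> t /= St i => [_|]; exact: St.
apply: fin_bigcap_measurable => // i _.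
by rewrite -[X in measurable X]setTI; exact: measurable_tnth.
Qed.

Lemma iid_all_full d (T : measurableType d) (R : realType)
    (P : probability T R) (S : set T) n : measurable S -> P S = 1%E ->
  iid P n [set t : n.-tuple T | forall i, S (tnth t i)] = 1%E.
Proof. by move=> mS PS; rewrite (iid_rectangle P (fun=> mS)) big1. Qed.

Section uniform_deviation.
Context (R : realType) (V : normedModType R) (X : set V) (x0 : X).
Local Notation T := (feature x0).
Context (P : probability T R) (l u : {mfun T >-> R}) (fstar : T -> R).
Context (m B : R) (F : set (T -> R)) (S : set T) (s : nat -> T).
Context (between : forall x, l x <= fstar x <= u x) (Ffstar : F fstar).
Context (F_lip : lipschitz_class m F).
Context (mS : measurable S) (PS : P S = 1%E) (S_bounded : S `<=` bounded_data l u B).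
Context (s_dense : forall x, S x -> forall e, 0 < e -> exists k, dist x (s k) < e).

Lemma lipschitz_abs f x y : F f -> `|f x - f y| <= `|m| * dist x y.
Proof.
by move=> Ff; rewrite (le_trans (F_lip Ff x y))// ler_wpM2r ?dist_ge0// ler_norm.
Qed.

Lemma interval_loss_fstar x : interval_loss l u fstar x = 0.
Proof.
have /andP[lf fu] := between x; rewrite /interval_loss.
by rewrite !max_l ?addr0// subr_le0.
Qed.

Lemma interval_loss_eq0 f x : interval_loss l u f x = 0 -> l x <= f x <= u x.
Proof.
rewrite /interval_loss => h.
have h1 : 0 <= Num.max 0 (l x - f x) by rewrite le_max lexx.
have h2 : 0 <= Num.max 0 (f x - u x) by rewrite le_max lexx.
have h3 : l x - f x <= Num.max 0 (l x - f x) by rewrite le_max lexx orbT.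
have h4 : f x - u x <= Num.max 0 (f x - u x) by rewrite le_max lexx orbT.
by apply/andP; split; lra.
Qed.

Lemma dist_bounded x y : S x -> S y -> dist x y <= 2 * B.
Proof.
move=> /S_bounded[xB _ _] /S_bounded[yB _ _].
by rewrite /dist (le_trans (ler_normB _ _))//; lra.
Qed.

(** The loss vanishes at [fstar], so it is at most the distance from [f y] to [fstar y]; passing
    from [y] to [x] moves each of the two functions by at most [2 * B] times the Lipschitz
    constant. *)
Lemma interval_loss_bounded f x y : F f -> S x -> S y ->
  interval_loss l u f y <= `|f x - fstar x| + 4 * `|m| * B.
Proof.
move=> Ff Sx Sy.
have : interval_loss l u f y <= `|f y - fstar y|.
  have := interval_loss_lip between f fstar y.
  by rewrite interval_loss_fstar subr0 ger0_norm// interval_loss_ge0.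
have h1 := lipschitz_abs y x Ff; have h2 := lipschitz_abs x y Ffstar.
have h3 := dist_bounded Sx Sy.
have h4 := ler_wpM2l (normr_ge0 m) h3.
have h5 := ler_normD (f y - f x) (f x - fstar y).
have h6 := ler_normD (f x - fstar x) (fstar x - fstar y).
move: h5 h6; rewrite !addrA !subrK => h5 h6.
move: h1; rewrite (dist_sym y x) => h1.
lra.
Qed.

(** A fallback when the blocks are too short for the Rademacher bound. One consistent point
    suffices: there [f] and [fstar] both lie in an interval contained in [[- B, B]]. *)
Lemma consistent_loss_bounded : exists2 K : R, 0 < K & forall f x, F f -> S x ->
  interval_loss l u f x = 0 -> (\int[P]_y (interval_loss l u f y)%:E <= K%:E)%E.
Proof.
exists (`|2 * B + 4 * `|m| * B| + 1); first by rewrite ltr_pwDr.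
move=> f x Ff Sx /interval_loss_eq0/andP[lf fu].
apply: (le_integral_full mS PS) => [||y Sy].
- by apply: measurable_interval_loss; exact: measurable_lipschitz (F_lip Ff).
- exact: interval_loss_ge0.
have h1 := interval_loss_bounded Ff Sx Sy.
have h2 : `|f x - fstar x| <= 2 * B.
  have /andP[lfs fsu] := between x.
  have [_ + +] := S_bounded Sx; rewrite !ler_norml => /andP[? ?] /andP[? ?].
  by apply/andP; split; lra.
by have := ler_norm (2 * B + 4 * `|m| * B); lra.
Qed.

Definition mean_loss f : R := fine (\int[P]_x (interval_loss l u f x)%:E)%E.

Lemma integrable_interval_loss f : F f ->
  P.-integrable setT (EFin \o interval_loss l u f).
Proof.
move=> Ff.
have [x Sx] : S !=set0.
  apply/set0P/eqP => S0; move: PS; rewrite S0 measure0 => /esym/eqP.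
  by rewrite onee_eq0.
apply: (integrable_full mS PS) => [||y Sy].
- by apply: measurable_interval_loss; exact: measurable_lipschitz (F_lip Ff).
- exact: interval_loss_ge0.
exact: interval_loss_bounded Ff Sx Sy.
Qed.

Lemma mean_lossE f : F f ->
  (\int[P]_x (interval_loss l u f x)%:E = (mean_loss f)%:E)%E.
Proof.
move=> Ff; rewrite /mean_loss fineK//.
exact: (integrable_fin_num measurableT (integrable_interval_loss Ff)).
Qed.

(** By symmetrization the supremum of the deviations over a dense sequence has mean at most
    [2 * b * C / sqrt b], and Markov's inequality at [expR 1] times this level gives the
    probability. A consistent [f] of larger mean loss would be approximated by a member of the
    sequence with a deviation above the level. Samples leaving [S] are null and are put into [A]. *)
Lemma consistent_tail (b : nat) (C : R) : (0 < b)%N -> 0 < C ->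
  (`|rademacher P F b| <= (C / Num.sqrt b%:R)%:E)%E ->
  exists A : set (b.-tuple T), [/\ measurable A, (iid P b A <= (expR (-1))%:E)%E &
    forall t, ~ A t -> forall f, F f ->
      (forall i, interval_loss l u f (tnth t i) = 0) ->
      mean_loss f <= 2 * expR 1 * C / Num.sqrt b%:R].
Proof.
move=> b0 C0 radC.
(* Coordinate 0 controls the mean loss; the others are the values at the dense points. *)
pose e (j : nat) (f : T -> R) := if j is j'.+1 then f (s j') else mean_loss f.
have [fs [fs0 Ffs fs_dense]] := dense_sequence e Ffstar.
pose g k x := fs k x - fs 0%N x.
pose h k := interval_loss l u (fs k).
pose mu k := mean_loss (fs k).
have mfs k : measurable_fun setT (fs k).
  exact: measurable_lipschitz (F_lip (Ffs k)).
have mg k : measurable_fun setT (g k) by exact: measurable_funB.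
have mh k : measurable_fun setT (h k) by exact: measurable_interval_loss.
have muE k : (\int[P]_x (h k x)%:E = (mu k)%:E)%E by exact: mean_lossE.
have ih k : P.-integrable setT (EFin \o h k) by exact: integrable_interval_loss.
have g0 x : g 0%N x = 0 by rewrite /g subrr.
have h0 x : h 0%N x = 0 by rewrite /h fs0 interval_loss_fstar.
have contr j k x : `|h j x - h k x| <= `|g j x - g k x|.
  have -> : g j x - g k x = fs j x - fs k x by rewrite /g; ring.
  exact: interval_loss_lip.
pose z : nat -> R := fun=> 0.
pose r := Num.sqrt b%:R : R.
have r0 : 0 < r by rewrite sqrtr_gt0 ltr0n.
have b0R : 0 < b%:R :> R by rewrite ltr0n.
pose eps := 2 * expR 1 * C / r.
have eps0 : 0 < eps by rewrite divr_gt0// !mulr_gt0// expR_gt0.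
pose dev := @deviation _ T R h mu b z.
have mdev : measurable_fun setT dev by exact: measurable_deviation_tuple.
have dev0 t : (0 <= dev t)%E by exact: (deviation_ge0 muE h0).
have int_dev : (\int[iid P b]_t dev t <= (2 * b%:R * (C / r))%:E)%E.
  have step1 := @deviation_le_sign_average _ _ _ _ _ _ _
    mg mh muE ih g0 h0 contr b z erefl.
  apply: (le_trans step1).
  apply: (le_trans (sign_average_le_rademacher P Ffs mfs b0)).
  rewrite [leRHS]EFinM lee_wpmul2l//.
  by rewrite (le_trans _ radC)// lee_abs.
have mSb := measurable_tuple_all (n := b) mS; have PSb := iid_all_full b mS PS.
pose A1 := [set t | ((b%:R * eps)%:E <= `|dev t|)%E].
have mA1 : measurable A1.
  rewrite -[A1]setTI; apply: emeasurable_fun_c_infty => //.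
  exact: measurableT_comp.
have PA1 : (iid P b A1 <= (expR (-1))%:E)%E.
  have beps : 0 < b%:R * eps by rewrite mulr_gt0.
  have := @le_integral_abse _ _ _ (iid P b) setT measurableT dev _ mdev beps.
  rewrite setTI => H.
  have {}H : ((b%:R * eps)%:E * iid P b A1 <= (2 * b%:R * (C / r))%:E)%E.
    apply: (le_trans H); apply: le_trans int_dev.
    by under eq_integral do rewrite gee0_abs//.
  rewrite -(@lee_pmul2l _ (b%:R * eps)%:E)// ?lte_fin// (le_trans H)//.
  rewrite -EFinM lee_fin /eps expRN.
  have -> : b%:R * (2 * expR 1 * C / r) * (expR 1)^-1 =
    2 * b%:R * (C / r) * (expR 1 / expR 1) by ring.
  by rewrite divff ?mulr1// gt_eqF// expR_gt0.
exists (A1 `|` ~` [set t : b.-tuple T | forall i, S (tnth t i)]); split.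
- by apply: measurableU => //; exact: measurableC.
- apply: (le_trans (measureU2 _ _ _)) => //; first exact: measurableC.
  by rewrite [X in (_ + X)%E](probability_full_setC mSb PSb) adde0.
move=> t /not_orP[nA1 /contrapT St] f Ff f0.
rewrite -/r -/eps leNgt; apply/negP => eps_f.
(* The approximation may lose [d / 4] in mean loss and [d / 2] at each sample point, the latter
   split into [d / 4] at the nearby dense point and [d / 8] for each of two Lipschitz moves; [d / 4]
   remains. *)
pose d := mean_loss f - eps.
have d0 : 0 < d by rewrite subr_gt0.
have m1 : 0 < `|m| + 1 by rewrite ltr_pwDr.
pose d1 := d / 8 / (`|m| + 1).
have d10 : 0 < d1 by rewrite !divr_gt0.
have /choice[j tj] i := s_dense (St i) d10.
(* One unit for the strict inequality, one because evaluation coordinates are shifted by one in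
   [e]. *)
pose N := (\max_(i < b) j i).+2.
have [|k Hk] := fs_dense f Ff N (d / 4); first by rewrite divr_gt0.
apply: nA1; rewrite /A1 /= gee0_abs// (le_trans _ (seq_sup_ge _ k))// lee_fin add0r.
have hk i : h k (tnth t i) <= d / 2.
  have jN : (j i < N.-1)%N by rewrite ltnS (leq_bigmax i).
  have Hs : `|fs k (s (j i)) - f (s (j i))| < d / 4 by exact: (Hk (j i).+1).
  have H1 := lipschitz_abs (tnth t i) (s (j i)) (Ffs k).
  have H2 := lipschitz_abs (s (j i)) (tnth t i) Ff.
  have H3 : `|m| * dist (tnth t i) (s (j i)) <= d / 8.
    have := tj i; rewrite /d1 ltr_pdivlMr// => /ltW; apply: le_trans.
    by rewrite mulrC ler_wpM2l ?dist_ge0// lerDl.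
  have := interval_loss_lip between (fs k) f (tnth t i).
  rewrite f0 subr0 ger0_norm ?interval_loss_ge0// -/(h k (tnth t i)) => H4.
  move: H2; rewrite (dist_sym (s (j i))) => H2.
  have H5 := ler_normD (fs k (tnth t i) - fs k (s (j i))) (fs k (s (j i)) - f (tnth t i)).
  have H6 := ler_normD (fs k (s (j i)) - f (s (j i))) (f (s (j i)) - f (tnth t i)).
  by move: H5 H6; rewrite !addrA !subrK => H5 H6; lra.
have muk : mean_loss f - d / 4 <= mu k.
  have : `|mu k - mean_loss f| < d / 4 by exact: (Hk 0%N).
  by rewrite ltr_norml => /andP[]; lra.
have -> : b%:R * eps = \sum_(i < b) eps by rewrite sumr_const card_ord mulr_natl.
by apply: ler_sum => i _; have := hk i; rewrite /d in muk *; lra.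
Qed.

End uniform_deviation.

(** * The sample complexity bound *)

Lemma probability_full_setI d (T : measurableType d) (R : realType)
    (P : probability T R) (A B : set T) :
  measurable A -> measurable B -> P A = 1%E -> P B = 1%E -> P (A `&` B) = 1%E.
Proof.
move=> mA mB PA PB; have mAB := measurableI _ _ mA mB.
suff PC : P (~` (A `&` B)) = 0%E.
  by rewrite -[A `&` B]setCK probability_setC ?PC ?sube0//; exact: measurableC.
apply/eqP; rewrite eq_le measure_ge0 andbT setCI.
apply: (le_trans (measureU2 _ _ _)); try exact: measurableC.
by rewrite [X in (X + _)%E](probability_full_setC mA PA)
           [X in (_ + X)%E](probability_full_setC mB PB) adde0.
Qed.

Lemma sqrt_le_confidence (R : realType) (n q L : R) : 0 <= q -> 0 <= L ->
  n <= q * (L + 1) -> Num.sqrt n <= Num.sqrt q * (1 + Num.sqrt L).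
Proof.
move=> q0 L0 nq; apply: (le_trans (ler_wsqrtr nq)); rewrite sqrtrM// ler_wpM2l//.
have s0 := sqrtr_ge0 L.
rewrite -[leRHS]ger0_norm ?addr_ge0// -sqrtr_sqr ler_wsqrtr//.
by rewrite sqrrD sqr_sqrtr//; lra.
Qed.

Lemma projection_lossE (R : realType) (V : normedModType R) (X : set V) (x0 : X)
    (l u : {mfun feature x0 >-> R}) (loss : R -> R -> R) (f : feature x0 -> R) x :
  (forall y y', loss y y' = `|y - y'|) ->
  projection_loss loss f (x, l x, u x) = interval_loss l u f x.
Proof.
move=> lossE; rewrite /projection_loss /interval_loss /= !lossE; congr (_ + _).
  case: ltP => h; last by rewrite mul0r max_l// subr_le0.
  by rewrite mul1r max_r ?subr_ge0 1?ltW// ltr0_norm ?subr_lt0// opprB.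
case: ltP => h; last by rewrite mul0r max_l// subr_le0.
by rewrite mul1r max_r ?subr_ge0 1?ltW// gtr0_norm ?subr_gt0.
Qed.

Lemma minimizer_consistent (R : realType) (V : normedModType R) (X : set V) (x0 : X)
    (l u : {mfun feature x0 >-> R}) (loss : R -> R -> R) (F : set (feature x0 -> R))
    (fstar f : feature x0 -> R) n (s : n.-tuple (feature x0 * R * R)%type) :
  (forall y y', loss y y' = `|y - y'|) -> (forall x, l x <= fstar x <= u x) ->
  F fstar -> (forall i, tnth s i = interval_data l u (tnth s i).1.1) ->
  is_minimizer loss F s f ->
  forall i, interval_loss l u f (tnth s i).1.1 = 0.
Proof.
move=> lossE between Ffs sE [_ /(_ fstar Ffs) fmin].
have objE g : projection_objective loss s g =
    \sum_(i < n) interval_loss l u g (tnth s i).1.1.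
  by apply: eq_bigr => i _; rewrite [in LHS]sE projection_lossE.
move: fmin; rewrite !objE [leRHS]big1 => [le0 i|i _]; last exact: interval_loss_fstar.
have loss0 j : 0 <= interval_loss l u f (tnth s j).1.1 by exact: interval_loss_ge0.
have /psumr_eq0P sum0 : \sum_(j < n) interval_loss l u f (tnth s j).1.1 = 0.
  by apply/eqP; rewrite eq_le le0 sumr_ge0.
exact: sum0.
Qed.

(** Since [n < (b + 1) * k] and [k <= L + 1], [sqrt n] is at most [sqrt (b + 1) * (1 + sqrt L)]. The
    summand [2 * a] of the constant handles nonempty blocks, the summand [K * sqrt N0] the short
    ones. *)
Lemma block_rate (R : realType) (n b k : nat) (L a K N0 : R) :
  (0 < n)%N -> 0 <= L -> k%:R <= L + 1 -> (0 < k)%N -> b = (n %/ k)%N ->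
  0 < a -> 0 < K -> 1 <= N0 ->
  let rate := (2 * a + K * Num.sqrt N0) / Num.sqrt n%:R +
    (2 * a + K * Num.sqrt N0) * Num.sqrt (L / n%:R) in
  ((0 < b)%N -> a / Num.sqrt b%:R <= rate) /\ (b.+1%:R <= N0 -> K <= rate).
Proof.
move=> n0 L0 kL k0 bE a0 K0 N01 rate.
have n0R : 0 < n%:R :> R by rewrite ltr0n.
have sn0 : 0 < Num.sqrt n%:R :> R by rewrite sqrtr_gt0.
have sL0 := sqrtr_ge0 L; have sN0 := sqrtr_ge0 N0.
have rateE : rate = (2 * a + K * Num.sqrt N0) * ((1 + Num.sqrt L) / Num.sqrt n%:R).
  by rewrite /rate sqrtrM// sqrtrV ?ler0n//; ring.
have n_bk : n%:R <= b.+1%:R * (L + 1).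
  rewrite (@le_trans _ _ (b.+1%:R * k%:R))//; last by rewrite ler_wpM2l.
  by rewrite -natrM ler_nat bE ltnW// ltn_ceil.
split=> [b0|bN]; rewrite rateE mulrA ler_pdivlMr//.
  have b0R : 0 < b%:R :> R by rewrite ltr0n.
  have sb0 : 0 < Num.sqrt b%:R :> R by rewrite sqrtr_gt0.
  (* The crude bound [b + 1 <= 4 * b] is taken because 4 has an exact square root, the 2 of
     [2 * a]. *)
  have h : Num.sqrt n%:R <= Num.sqrt (4 * b%:R) * (1 + Num.sqrt L) :> R.
    apply: sqrt_le_confidence => //.
    rewrite (le_trans n_bk)// ler_wpM2r ?addr_ge0// -natrM ler_nat.
    by rewrite mulSn -addn1 leq_add2l muln_gt0.
  have s4 : Num.sqrt (4 * b%:R) = 2 * Num.sqrt b%:R :> R.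
    by rewrite sqrtrM// (_ : 4 = 2 ^+ 2) ?sqrtr_sqr ?ger0_norm//; ring.
  rewrite mulrAC ler_pdivrMr//.
  apply: (@le_trans _ _ (a * (2 * Num.sqrt b%:R * (1 + Num.sqrt L)))).
    by rewrite (ler_wpM2l (ltW a0))// -s4.
  have : 0 <= K * Num.sqrt N0 * ((1 + Num.sqrt L) * Num.sqrt b%:R).
    by rewrite !mulr_ge0 ?addr_ge0// ltW.
  by lra.
have h : Num.sqrt n%:R <= Num.sqrt N0 * (1 + Num.sqrt L) :> R.
  apply: sqrt_le_confidence => //; first by lra.
  by rewrite (le_trans n_bk)// ler_wpM2r ?addr_ge0.
apply: (@le_trans _ _ (K * (Num.sqrt N0 * (1 + Num.sqrt L)))).
  by rewrite (ler_wpM2l (ltW K0)).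
have : 0 <= a * (1 + Num.sqrt L) by rewrite mulr_ge0 ?addr_ge0// ltW.
by lra.
Qed.

Theorem theorem4p1 (R : realType) (V : normedModType R) (X : set V) (x0 : X)
    (Y : set R) (P : probability (feature x0) R)
    (nu : {measure set (feature x0) -> \bar R}) (p : feature x0 -> R)
    (l u : {mfun feature x0 >-> R}) (fstar : feature x0 -> R)
    (loss : R -> R -> R) (m : R) (F : set (feature x0 -> R))
    (density_p : is_density nu P p)
    (nonatomic_P : nonatomic P p)
    (F_valued : forall f, F f -> forall x, Y (f x))
    (fstar_between : forall x, l x <= fstar x <= u x)
    (realizable : F fstar)
    (lipschitz_F : lipschitz_class m F)
    (rademacher_F : exists C : R, \forall n \near \oo,
      (`|rademacher P F n| <= (C / Num.sqrt n%:R)%:E)%E)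
    (bounded_support : bounded_set
      [set ((set_val z.1.1, z.1.2, z.2) : V * R * R)
         | z in measure_support (interval_law l u P)])
    (lossE : forall y y', loss y y' = `|y - y'|) :
  (exists D M : R, forall (n : nat) (delta : R),
     (0 < n)%N -> 0 < delta < 1 ->
     with_prob_ge (iid (interval_law l u P) n) (1 - delta)
       [set s | forall f, is_minimizer loss F s f ->
          forall tau : R, 0 < tau ->
          (err loss P fstar f <=
             \int[P]_x `|upper_bound u m p x - lower_bound l m p x|
             + tau%:E
             + (D / Num.sqrt n%:R + M * Num.sqrt (ln (1 / delta) / n%:R))%:E
               * Gamma l u m P p tau)%E])
  /\ (forall tau1 tau2 : R, 0 < tau1 -> tau1 <= tau2 ->
        (Gamma l u m P p tau2 <= Gamma l u m P p tau1)%E).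
Proof.
pose S0 : set (feature x0) := [set x | 0 < p x].
have mS0 : measurable S0 by exact: measurable_density_pos density_p.
have PS0 : P S0 = 1%E by exact: density_pos_full density_p.
have S0n0 : S0 !=set0.
  apply/set0P/eqP => S00; move: PS0; rewrite S00 measure0 => /esym/eqP.
  by rewrite onee_eq0.
split; last first.
  move=> tau1 tau2 _; apply: (Gamma_nonincreasing P S0n0 fstar_between).
  exact: lipschitz_F.
have [s s_dense] := support_separable S0n0
  (fun x px e e0 => density_pos_ball nonatomic_P px e0).
have [B [mB PB]] := bounded_data_full mS0 PS0 s_dense bounded_support.
pose S := S0 `&` bounded_data l u B.
have mS : measurable S by exact: measurableI.
have PS : P S = 1%E by exact: probability_full_setI.
have SB : S `<=` bounded_data l u B by move=> x [].
have sS x : S x -> forall e, 0 < e -> exists k, dist x (s k) < e.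
  by move=> [S0x _]; exact: s_dense.
have [K K0 HK] := consistent_loss_bounded fstar_between realizable lipschitz_F mS PS SB.
have [C [N _ HN]] := rademacher_F.
pose C0 := `|C| + 1.
have C00 : 0 < C0 by rewrite ltr_pwDr.
pose a := 2 * expR 1 * C0.
have a0 : 0 < a by rewrite !mulr_gt0// expR_gt0.
(* The constant of [block_rate], serving for both [D] and [M]. Blocks with [b <= N + 1] count as
   short, whence [N + 2]. *)
pose D := 2 * a + K * Num.sqrt N.+2%:R.
exists D, D => n delta n0 /andP[delta0 delta1].
pose L := ln (1 / delta).
have L0 : 0 < L by rewrite ln_gt0// div1r invf_gt1.
(* [k > L] gives [expR (- k) <= delta], while [k <= L + 1] keeps the blocks long. *)
pose k := (Num.truncn L).+1.
pose b := (n %/ k)%N.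
have kL : k%:R <= L + 1 by rewrite -natr1 lerD2r truncn_le ltW.
have N1 : 1 <= N.+2%:R :> R by rewrite ler1n.
have [] := block_rate n0 (ltW L0) kL (ltn0Sn _) (erefl b) a0 K0 N1.
rewrite -/D; set rate := D / _ + _ => rate_b rate_K.
have rate0 : 0 < rate.
  have n0R : 0 < n%:R :> R by rewrite ltr0n.
  have D0 : 0 < D by rewrite addr_gt0 ?mulr_gt0 ?sqrtr_gt0 ?ltr0n.
  by rewrite addr_gt0 ?(divr_gt0 D0) ?(mulr_gt0 D0) ?sqrtr_gt0 ?divr_gt0.
have [E [mE PE HE]] : exists E : set (n.-tuple (feature x0)),
    [/\ measurable E, (iid P n E <= delta%:E)%E &
     forall t, ~ E t -> (forall i, S (tnth t i)) -> forall f, F f ->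
       (forall i, interval_loss l u f (tnth t i) = 0) ->
       (\int[P]_x (interval_loss l u f x)%:E <= rate%:E)%E].
  (* Short blocks need no exceptional event: one sample point, available as [n > 0], bounds the loss
     by [K]. *)
  have [bN|Nb] := leqP b N.+1.
    exists set0; split=> //; first by rewrite measure0 lee_fin ltW.
    move=> t _ St f Ff f0.
    have i0 : 'I_n := Ordinal n0.
    rewrite (le_trans (HK f (tnth t i0) Ff (St _) (f0 _)))// lee_fin rate_K//.
    by rewrite ler_nat.
  have b0 : (0 < b)%N by rewrite (leq_trans _ Nb).
  have radb : (`|rademacher P F b| <= (C0 / Num.sqrt b%:R)%:E)%E.
    apply: (le_trans (HN b _)); first exact: ltnW (ltnW Nb).
    rewrite lee_fin ler_wpM2r ?invr_ge0 ?sqrtr_ge0// /C0.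
    by have := ler_norm C; lra.
  have [A [mA PA HA]] := consistent_tail fstar_between realizable
    lipschitz_F mS PS SB sS b0 C00 radb.
  have [|E [mE PE HE]] := iid_blocks mA PA (k := k) (n := n).
    by rewrite mulnC leq_trunc_div.
  exists E; split=> //.
    rewrite (le_trans PE)// lee_fin -expRM_natl mulrN1.
    have -> : delta = expR (- L) by rewrite /L div1r lnV ?posrE// opprK lnK// posrE.
    by rewrite ler_expR lerN2 ltW// truncnS_gt.
  move=> t nEt St f Ff f0.
  have [s' [nAs' s't]] := HE t nEt.
  rewrite (mean_lossE fstar_between realizable lipschitz_F mS PS SB Ff) lee_fin.
  rewrite (le_trans _ (rate_b b0))//.
  apply: HA nAs' _ Ff _ => i; have [j ->] := s't i; exact: f0.
pose Z := (feature x0 * R * R)%type.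
have mproj : measurable_fun setT
    (fun z : n.-tuple Z => map_tuple (fun w : Z => w.1.1) z).
  apply/measurable_fun_tnthP => i.
  rewrite (_ : _ \o _ = fun z => (tnth z i).1.1); last first.
    by apply/funext => z /=; rewrite tnth_map.
  apply: (measurableT_comp (f := fun w : Z => w.1.1)).
    exact: measurableT_comp.
  exact: measurable_tnth.
have mSn := measurable_tuple_all (n := n) mS; have PSn := iid_all_full n mS PS.
pose E' := ~` E `&` [set t : n.-tuple (feature x0) | forall i, S (tnth t i)].
have mE' : measurable E' by apply: measurableI => //; exact: measurableC.
(* Samples range over arbitrary triples, but only for triples in [G] is the projection loss equal to
   [interval_loss]. *)
pose G := [set w : Z | w = interval_data l u w.1.1].
have mG : measurable G.
  have meq (f g : Z -> R) : measurable_fun setT f -> measurable_fun setT g ->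
      measurable [set w | f w = g w].
    move=> mf mg; rewrite (_ : mkset _ = setT `&` (fun w => f w - g w) @^-1` [set 0]).
      by apply: measurable_funB.
    by rewrite setTI; apply/seteqP; split=> w /= /eqP; rewrite ?subr_eq0 => /eqP;
      rewrite // => ->; rewrite subrr.
  have m11 : measurable_fun setT (fun w : Z => w.1.1) by exact: measurableT_comp.
  rewrite (_ : G = [set w : Z | w.1.2 = l w.1.1] `&` [set w : Z | w.2 = u w.1.1]).
    apply: measurableI; apply: meq => //; try exact: measurableT_comp.
  apply/seteqP; split=> -[[x r] r']; rewrite /G /interval_data/=.
    by case=> <- <-.
  by case=> <- <-.
have mGn := measurable_tuple_all (n := n) mG.
exists ((fun z => map_tuple (fun w : Z => w.1.1) z) @^-1` E' `&`
  [set z | forall i, G (tnth z i)]); split.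
- apply: measurableI => //; rewrite -[X in measurable X]setTI.
  exact: mproj.
- move=> z [[nEz Sz] Gz] f fmin tau tau0.
  have [Ff _] := fmin.
  have f0 := minimizer_consistent lossE fstar_between realizable Gz fmin.
  rewrite /err; under eq_integral do rewrite lossE.
  apply: (risk_bound S0n0 fstar_between (lipschitz_F _ realizable)
    (lipschitz_F _ Ff) rate0 tau0).
  by apply: (HE _ nEz Sz f Ff) => i; rewrite tnth_map; exact: f0.
(* Pulled back to features, membership in [G] is automatic and the event becomes [E'], whose
   complement is [E] up to a null set. *)
- rewrite iid_distribution; last first.
    by apply: measurableI => //; rewrite -[X in measurable X]setTI; exact: mproj.
  rewrite (_ : mkset _ = E').
    pose Sn := [set t : n.-tuple (feature x0) | forall i, S (tnth t i)].
    have E'E : E' = ~` (E `|` ~` Sn).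
      by rewrite setCU setCK.
    have mU : measurable (E `|` ~` Sn).
      by apply: measurableU => //; exact: measurableC.
    rewrite E'E probability_setC// EFinB leeB//.
    apply: (le_trans (measureU2 _ _ _)) => //; first exact: measurableC.
    by rewrite [X in (_ + X)%E](probability_full_setC mSn PSn) adde0.
  apply/seteqP; split=> t /=.
    by move=> [+ _]; congr (E' _); apply: eq_from_tnth => i; rewrite !tnth_map.
  move=> E't; split; last by move=> i; rewrite /G/= tnth_map.
  by move: E't; congr (E' _); apply: eq_from_tnth => i; rewrite !tnth_map.
Qed.
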